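(* Let $\mathcal{A}$ be an abelian category with enough projectives, let $\mathcal{B}$ be an abelian category with enough injectives, and let $\mathrm{F}\colon\mathcal{A}\rightleftarrows\mathcal{B}\colon\mathrm{G}$ be an adjunction with $\mathrm{F}$ left adjoint of $\mathrm{G}$. If $(\mathrm{F},\mathrm{G})$ is a tilting adjunction, then for every integer $\ell$ the functors $\mathrm{L}_\ell\mathrm{F}$ and $\mathrm{R}^\ell\mathrm{G}$ restrict to an adjoint equivalence between the full subcategories $$\{A\in\mathcal{A} \mid \mathrm{L}_i\mathrm{F}(A)=0 \text{ for all } i\neq\ell\} \quad\text{and}\quad \{B\in\mathcal{B} \mid \mathrm{R}^i\mathrm{G}(B)=0 \text{ for all } i\neq\ell\},$$ where $\mathrm{L}_\ell\mathrm{F}$ goes from the former to the latter and $\mathrm{R}^\ell\mathrm{G}$ from the latter to the former.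
   Context: $\mathrm{L}_i\mathrm{F}$ and $\mathrm{R}^i\mathrm{G}$ denote the $i$-th left derived functor of $\mathrm{F}$ and the $i$-th right derived functor of $\mathrm{G}$ (zero for $i<0$). An object $B\in\mathcal{B}$ is $\mathrm{G}$-acyclic if $\mathrm{R}^i\mathrm{G}(B)=0$ for all $i>0$; an object $A\in\mathcal{A}$ is $\mathrm{F}$-acyclic if $\mathrm{L}_i\mathrm{F}(A)=0$ for all $i>0$. $\mathrm{G}$ has finite cohomological dimension if $\mathrm{R}^d\mathrm{G}=0$ for some integer $d\geq 0$; $\mathrm{F}$ has finite homological dimension if $\mathrm{L}_d\mathrm{F}=0$ for some integer $d\geq 0$. Let $\eta$ and $\varepsilon$ be the unit and counit of $(\mathrm{F},\mathrm{G})$. The adjunction $(\mathrm{F},\mathrm{G})$ is a tilting adjunction if: (TA1) for every projective object $P\in\mathcal{A}$ the object $\mathrm{F}(P)$ is $\mathrm{G}$-acyclic and $\eta_P\colon P\to\mathrm{G}\mathrm{F}(P)$ is an isomorphism; (TA2) $\mathrm{G}$ has finite cohomological dimension; (TA3) for every injective object $I\in\mathcal{B}$ the object $\mathrm{G}(I)$ is $\mathrm{F}$-acyclic and $\varepsilon_I\colon\mathrm{F}\mathrm{G}(I)\to I$ is an isomorphism; (TA4) $\mathrm{F}$ has finite homological dimension. *)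

(* Defs.v *)
From mathcomp Require Import all_boot all_order all_algebra.
From mathcomp Require Import boolp.

Set Implicit Arguments.
Unset Strict Implicit.
Unset Printing Implicit Defensive.

Import GRing.Theory.
Local Open Scope ring_scope.

Reserved Notation "g ∘ f" (at level 40, left associativity).

(* Preadditive categories: the Hom-sets are abelian groups.  Equality of
   morphisms is Leibniz equality. *)
Record category := Category {
  obj :> Type;
  hom : obj -> obj -> zmodType;
  idm : forall X, hom X X;
  mcomp : forall X Y Z, hom Y Z -> hom X Y -> hom X Z;
  mcompA : forall W X Y Z (h : hom Y Z) (g : hom X Y) (f : hom W X),
    mcomp h (mcomp g f) = mcomp (mcomp h g) f;
  mcomp1m : forall X Y (f : hom X Y), mcomp (idm Y) f = f;
  mcompm1 : forall X Y (f : hom X Y), mcomp f (idm X) = f;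
  mcompDl : forall X Y Z (g h : hom Y Z) (f : hom X Y),
    mcomp (g + h) f = mcomp g f + mcomp h f;
  mcompDr : forall X Y Z (g : hom Y Z) (f h : hom X Y),
    mcomp g (f + h) = mcomp g f + mcomp g h
}.

Arguments hom {c} X Y : rename.
Arguments idm {c} X : rename.
Arguments mcomp {c X Y Z} g f : rename.
Notation "g ∘ f" := (mcomp g f).

Section CategoryTheory.
Variable A : category.
Implicit Types X Y Z : A.

Lemma mcomp0m X Y Z (f : hom X Y) : (0 : hom Y Z) ∘ f = 0.
Proof. by apply: (@addrI _ (0 ∘ f)); rewrite -mcompDl !addr0. Qed.

Lemma mcompm0 X Y Z (g : hom Y Z) : g ∘ (0 : hom X Y) = 0.
Proof. by apply: (@addrI _ (g ∘ 0)); rewrite -mcompDr !addr0. Qed.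

Lemma mcompNl X Y Z (g : hom Y Z) (f : hom X Y) : (- g) ∘ f = - (g ∘ f).
Proof. by apply: (@addrI _ (g ∘ f)); rewrite -mcompDl !subrr mcomp0m. Qed.

Lemma mcompNr X Y Z (g : hom Y Z) (f : hom X Y) : g ∘ (- f) = - (g ∘ f).
Proof. by apply: (@addrI _ (g ∘ f)); rewrite -mcompDr !subrr mcompm0. Qed.

Definition is_iso X Y (f : hom X Y) : Prop :=
  exists g : hom Y X, g ∘ f = idm X /\ f ∘ g = idm Y.

Definition mono X Y (f : hom X Y) : Prop :=
  forall W (g h : hom W X), f ∘ g = f ∘ h -> g = h.

Definition epi X Y (f : hom X Y) : Prop :=
  forall W (g h : hom Y W), g ∘ f = h ∘ f -> g = h.

(* Initial and terminal. *)
Definition is_zero X : Prop :=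
  (forall Y (f : hom X Y), f = 0) /\ (forall Y (f : hom Y X), f = 0).

Definition is_kernel X Y K (f : hom X Y) (k : hom K X) : Prop :=
  f ∘ k = 0 /\
  forall W (h : hom W X), f ∘ h = 0 -> exists! u : hom W K, k ∘ u = h.

Definition is_cokernel X Y Q (f : hom X Y) (q : hom Y Q) : Prop :=
  q ∘ f = 0 /\
  forall W (h : hom Y W), h ∘ f = 0 -> exists! u : hom Q W, u ∘ q = h.

Record is_biproduct X Y S (i : hom X S) (j : hom Y S)
    (p : hom S X) (q : hom S Y) : Prop := IsBiproduct {
  biprod_pi : p ∘ i = idm X;
  biprod_qj : q ∘ j = idm Y;
  biprod_pj : p ∘ j = 0;
  biprod_qi : q ∘ i = 0;
  biprod_id : i ∘ p + j ∘ q = idm S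
}.

Record abelian : Prop := Abelian {
  has_zero : exists Z : A, is_zero Z;
  has_biproducts : forall X Y, exists (S : A) (i : hom X S) (j : hom Y S)
    (p : hom S X) (q : hom S Y), is_biproduct i j p q;
  has_kernels : forall X Y (f : hom X Y),
    exists (K : A) (k : hom K X), is_kernel f k;
  has_cokernels : forall X Y (f : hom X Y),
    exists (Q : A) (q : hom Y Q), is_cokernel f q;
  mono_is_kernel : forall X Y (f : hom X Y), mono f ->
    exists (Z : A) (g : hom Y Z), is_kernel g f;
  epi_is_cokernel : forall X Y (f : hom X Y), epi f ->
    exists (W : A) (g : hom W X), is_cokernel g f
}.

Definition projective_obj (P : A) : Prop :=
  forall X Y (e : hom X Y) (f : hom P Y), epi e ->
  exists g : hom P X, e ∘ g = f.

Definition injective_obj (I : A) : Prop :=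
  forall X Y (m : hom Y X) (f : hom Y I), mono m ->
  exists g : hom X I, g ∘ m = f.

Definition enough_projectives : Prop :=
  forall X, exists (P : A) (e : hom P X), projective_obj P /\ epi e.

Definition enough_injectives : Prop :=
  forall X, exists (I : A) (m : hom X I), injective_obj I /\ mono m.

(* Image of f = kernel of g: f is an epimorphism followed by a kernel of g. *)
Definition exact X Y Z (f : hom X Y) (g : hom Y Z) : Prop :=
  exists (K : A) (e : hom X K) (k : hom K Y),
    [/\ epi e, is_kernel g k & f = k ∘ e].

Lemma kernel_mono X Y K (f : hom X Y) (k : hom K X) : is_kernel f k -> mono k.
Proof.
move=> [fk0 univ] W g h kgh.
have [|u [_ uniq]] := univ W (k ∘ g); first by rewrite mcompA fk0 mcomp0m.
by rewrite -(uniq g) // -(uniq h).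
Qed.

Lemma cokernel_epi X Y Q (f : hom X Y) (q : hom Y Q) : is_cokernel f q -> epi q.
Proof.
move=> [qf0 univ] W g h gqh.
have [|u [_ uniq]] := univ W (g ∘ q); first by rewrite -mcompA qf0 mcompm0.
by rewrite -(uniq g) // -(uniq h).
Qed.

Lemma exact_comp0 X Y Z (f : hom X Y) (g : hom Y Z) : exact f g -> g ∘ f = 0.
Proof. by move=> [K [e [k [_ [gk0 _] ->]]]]; rewrite mcompA gk0 mcomp0m. Qed.

Lemma exact_lift P X Y Z (f : hom X Y) (g : hom Y Z) (h : hom P Y) :
  projective_obj P -> exact f g -> g ∘ h = 0 -> exists u, f ∘ u = h.
Proof.
move=> projP [K [e [k [epie [_ univ] ->]]]] /univ[v [kv _]].
by have [u eu] := projP _ _ e v epie; exists u; rewrite -mcompA eu.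
Qed.

End CategoryTheory.

Record abelian_category := AbelianCategory {
  ab_cat :> category;
  ab_axioms : abelian ab_cat
}.

Section Opposite.

Definition op_category (A : category) : category :=
  @Category A (fun X Y => hom Y X) (fun X => idm X)
    (fun X Y Z g f => f ∘ g)
    (fun W X Y Z h g f => esym (mcompA f g h))
    (fun X Y f => mcompm1 f) (fun X Y f => mcomp1m f)
    (fun X Y Z g h f => mcompDr f g h) (fun X Y Z g f h => mcompDl f h g).

Lemma op_abelian (A : category) : abelian A -> abelian (op_category A).
Proof.
case=> z b k c m e; split.
- by have [Z [Z1 Z2]] := z; exists Z; split.
- move=> X Y; have [S [i [j [p [q [h1 h2 h3 h4 h5]]]]]] := b X Y.
  by exists S, p, q, i, j; split.
- by move=> X Y f; exact: c.
- by move=> X Y f; exact: k.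
- by move=> X Y f; exact: e.
- by move=> X Y f; exact: m.
Qed.

Definition op_abelian_category (A : abelian_category) : abelian_category :=
  AbelianCategory (op_abelian (ab_axioms A)).

Lemma op_enough_projectives (A : category) :
  enough_injectives A -> enough_projectives (op_category A).
Proof. by []. Qed.

End Opposite.

Record functor (A B : category) := Functor {
  fobj :> A -> B;
  fmap : forall X Y, hom X Y -> hom (fobj X) (fobj Y);
  fmap1 : forall X, fmap (idm X) = idm (fobj X);
  fmapM : forall X Y Z (g : hom Y Z) (f : hom X Y),
    fmap (g ∘ f) = fmap g ∘ fmap f
}.

Arguments fmap {A B} F {X Y} f : rename.

Definition additive_functor (A B : category) (F : functor A B) : Prop :=
  forall X Y (f g : hom X Y), fmap F (f + g) = fmap F f + fmap F g.

Lemma fmap0 (A B : category) (F : functor A B) (X Y : A) :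
  additive_functor F -> fmap F (0 : hom X Y) = 0.
Proof.
by move=> addF; apply: (@addrI _ (fmap F 0)); rewrite -addF !addr0.
Qed.

Definition op_functor (A B : category) (F : functor A B) :
    functor (op_category A) (op_category B) :=
  @Functor (op_category A) (op_category B) F (fun X Y f => fmap F f)
    (fun X => fmap1 F X) (fun X Y Z g f => fmapM F f g).

Definition unop_functor (A B : category)
    (F : functor (op_category A) (op_category B)) : functor A B :=
  @Functor A B (fobj F)
    (fun X Y (f : hom X Y) => @fmap _ _ F Y X f)
    (fun X => fmap1 F X)
    (fun X Y Z g f => @fmapM _ _ F Z Y X f g).

Definition const_zero_functor (A B : category) (Z : B) (Z0 : is_zero Z) :
    functor A B.
Proof.
exists (fun=> Z) (fun X Y _ => 0) => [X|X Y W g f].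
  by rewrite (Z0.1 _ (idm Z)).
by rewrite mcompm0.
Defined.

Section Adjunction.

(* F is left adjoint to G. *)
Record adjunction (A B : category) (F : functor A B) (G : functor B A) :=
  Adjunction {
    unit : forall X : A, hom X (G (F X));
    counit : forall Y : B, hom (F (G Y)) Y;
    unit_nat : forall (X Y : A) (f : hom X Y),
      unit Y ∘ f = fmap G (fmap F f) ∘ unit X;
    counit_nat : forall (X Y : B) (f : hom X Y),
      f ∘ counit X = counit Y ∘ fmap F (fmap G f);
    unit_counit : forall X : A, counit (F X) ∘ fmap F (unit X) = idm (F X);
    counit_unit : forall Y : B, fmap G (counit Y) ∘ unit (G Y) = idm (G Y)
  }.

Definition op_adjunction (A B : category) (F : functor A B) (G : functor B A)
    (adj : adjunction F G) : adjunction (op_functor G) (op_functor F) :=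
  @Adjunction (op_category B) (op_category A) (op_functor G) (op_functor F)
    (fun X => counit adj X) (fun Y => unit adj Y)
    (fun X Y f => counit_nat adj f) (fun X Y f => unit_nat adj f)
    (fun X => counit_unit adj X) (fun Y => unit_counit adj Y).

Lemma left_adjoint_additive (A B : abelian_category)
  (F : functor A B) (G : functor B A) :
  adjunction F G -> additive_functor F.
Proof.
move=> adj.
have tr X Y (u v : hom (F X) Y) :
    fmap G u ∘ unit adj X = fmap G v ∘ unit adj X -> u = v.
  have E (w : hom (F X) Y) : w = counit adj Y ∘ fmap F (fmap G w ∘ unit adj X).
    by rewrite fmapM mcompA -counit_nat -mcompA unit_counit mcompm1.
  by move=> uv; rewrite (E u) uv -E.
have [Z [Z1 Z2]] := has_zero (ab_axioms A).
have F0 X Y : fmap F (0 : hom X Y) = 0.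
  have FZ : idm (F Z) = 0 by apply: tr; rewrite (Z1 _ (_ ∘ _)) [RHS]Z1.
  rewrite -(mcomp0m Y (0 : hom X Z)) fmapM -[fmap F (0 : hom Z Y)]mcompm1 FZ.
  by rewrite mcompm0 mcomp0m.
move=> X Y f g.
have [S [i [j [p [q [pi qj pj qi ipjq]]]]]] := has_biproducts (ab_axioms A) X X.
have FS : fmap F i ∘ fmap F p + fmap F j ∘ fmap F q = idm (F S).
  set t := (_ + _).
  have ti : t ∘ fmap F i = fmap F i.
    rewrite /t mcompDl -!mcompA -!fmapM pi qi !mcompm0 F0 addr0.
    by rewrite mcompm1.
  have tj : t ∘ fmap F j = fmap F j.
    rewrite /t mcompDl -!mcompA -!fmapM pj qj !mcompm0 F0 add0r.
    by rewrite mcompm1.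
  apply: tr; rewrite fmap1 mcomp1m -[LHS]mcompm1 -[RHS]mcompm1 -ipjq !mcompDr.
  rewrite !mcompA; congr (_ ∘ p + _ ∘ q).
    by rewrite -mcompA unit_nat mcompA -fmapM ti.
  by rewrite -mcompA unit_nat mcompA -fmapM tj.
pose m := f ∘ p + g ∘ q; pose h := i + j.
have mi : m ∘ i = f.
  by rewrite mcompDl -!mcompA pi qi mcompm1 mcompm0 addr0.
have mj : m ∘ j = g.
  by rewrite mcompDl -!mcompA pj qj mcompm1 mcompm0 add0r.
have ph : p ∘ h = idm X by rewrite mcompDr pi pj addr0.
have qh : q ∘ h = idm X by rewrite mcompDr qi qj add0r.
have -> : f + g = m ∘ h by rewrite mcompDr mi mj.
rewrite fmapM -[fmap F m]mcompm1 -FS mcompDr mcompDl !mcompA -!fmapM mi mj.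
by rewrite -!mcompA ph qh !mcompm1.
Qed.

Lemma right_adjoint_additive (A B : abelian_category)
  (F : functor A B) (G : functor B A) :
  adjunction F G -> additive_functor G.
Proof.
move=> adj X Y f g.
exact: (@left_adjoint_additive (op_abelian_category B) (op_abelian_category A)
          _ _ (op_adjunction adj) Y X f g).
Qed.

End Adjunction.

Section Complexes.
Variable A : category.

Record complex := Complex {
  cobj :> nat -> A;
  cdiff : forall n, hom (cobj n.+1) (cobj n);
  cdiff_cdiff : forall n, cdiff n ∘ cdiff n.+1 = 0
}.

Record chain_map (C D : complex) := ChainMap {
  cmap :> forall n, hom (C n) (D n);
  cmap_comm : forall n, cdiff D n ∘ cmap n.+1 = cmap n ∘ cdiff C n
}.

Definition homotopic (C D : complex) (f g : chain_map C D) : Prop :=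
  exists s : forall n, hom (C n) (D n.+1),
    f 0 = g 0 + cdiff D 0 ∘ s 0 /\
    forall n, f n.+1 = g n.+1 + (cdiff D n.+1 ∘ s n.+1 + s n ∘ cdiff C n).

Definition id_chain_map (C : complex) : chain_map C C.
Proof. by exists (fun n => idm (C n)) => n; rewrite mcompm1 mcomp1m. Defined.

Definition comp_chain_map (C D E : complex) (g : chain_map D E)
  (f : chain_map C D) : chain_map C E.
Proof.
exists (fun n => g n ∘ f n) => n.
by rewrite mcompA cmap_comm -mcompA cmap_comm mcompA.
Defined.

Record is_projective_resolution (X : A) (P : complex) (e : hom (P 0) X) : Prop :=
  IsProjectiveResolution {
    pres_proj : forall n, projective_obj (P n);
    pres_epi : epi e;
    pres_exact0 : exact (cdiff P 0) e;
    pres_exact : forall n, exact (cdiff P n.+1) (cdiff P n)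
  }.

Lemma comparison_exists (X Y : A) (P Q : complex)
  (eP : hom (P 0) X) (eQ : hom (Q 0) Y) (f : hom X Y) :
  is_projective_resolution eP -> is_projective_resolution eQ ->
  exists phi : chain_map P Q, eQ ∘ phi 0 = f ∘ eP.
Proof.
move=> [projP _ exP0 exP] [_ epiQ exQ0 exQ].
have [u0 u0P] := projP 0 _ _ eQ (f ∘ eP) epiQ.
have [u1 u1P] : exists u, cdiff Q 0 ∘ u = u0 ∘ cdiff P 0.
  apply: exact_lift (projP 1) exQ0 _.
  by rewrite mcompA u0P -mcompA (exact_comp0 exP0) mcompm0.
pose T n := {uv : hom (P n) (Q n) * hom (P n.+1) (Q n.+1) |
              cdiff Q n ∘ uv.2 = uv.1 ∘ cdiff P n}.
have step n (s : T n) : {w | cdiff Q n.+1 ∘ w = (sval s).2 ∘ cdiff P n.+1}.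
  apply: cid; apply: exact_lift (projP _) (exQ n) _.
  by case: s => -[u v] /= uvP; rewrite mcompA uvP -mcompA cdiff_cdiff mcompm0.
pose s0 : T 0 := exist _ (u0, u1) u1P.
pose st := fix st n : T n :=
  if n is m.+1 return T n then
    exist _ ((sval (st m)).2, sval (step m (st m))) (svalP (step m (st m)))
  else s0.
by exists (@ChainMap P Q (fun n => (sval (st n)).1) (fun n => svalP (st n))).
Qed.

Lemma comparison_homotopic (X Y : A) (P Q : complex)
  (eP : hom (P 0) X) (eQ : hom (Q 0) Y) (phi psi : chain_map P Q) :
  is_projective_resolution eP -> is_projective_resolution eQ ->
  eQ ∘ phi 0 = eQ ∘ psi 0 -> homotopic phi psi.
Proof.
move=> [projP _ _ _] [_ _ exQ0 exQ] eqe.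
pose d n := phi n - psi n.
have dP n : cdiff Q n ∘ d n.+1 = d n ∘ cdiff P n.
  by rewrite /d mcompDr mcompDl mcompNr mcompNl !cmap_comm.
have [s0 s0P] : exists s, cdiff Q 0 ∘ s = d 0.
  by apply: exact_lift (projP 0) exQ0 _; rewrite mcompDr mcompNr eqe subrr.
have [s1 s1P] : exists s, cdiff Q 1 ∘ s = d 1 - s0 ∘ cdiff P 0.
  apply: exact_lift (projP 1) (exQ 0) _.
  by rewrite mcompDr mcompNr mcompA s0P dP subrr.
pose T n := {uv : hom (P n) (Q n.+1) * hom (P n.+1) (Q n.+2) |
              cdiff Q n.+1 ∘ uv.2 = d n.+1 - uv.1 ∘ cdiff P n}.
have step n (s : T n) :
    {w | cdiff Q n.+2 ∘ w = d n.+2 - (sval s).2 ∘ cdiff P n.+1}.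
  apply: cid; apply: exact_lift (projP _) (exQ n.+1) _.
  case: s => -[u v] /= uvP; rewrite mcompDr mcompNr mcompA uvP dP.
  by rewrite mcompDl mcompNl -mcompA cdiff_cdiff mcompm0 subr0 subrr.
pose t0 : T 0 := exist _ (s0, s1) s1P.
pose st := fix st n : T n :=
  if n is m.+1 return T n then
    exist _ ((sval (st m)).2, sval (step m (st m))) (svalP (step m (st m)))
  else t0.
exists (fun n => (sval (st n)).1); split=> [|n].
  by rewrite /= s0P /d addrC subrK.
have E : cdiff Q n.+1 ∘ (sval (st n.+1)).1 = _ := svalP (st n).
by rewrite E subrK /d addrC subrK.
Qed.

End Complexes.

Section FunctorComplex.
Variables (A B : category) (F : functor A B) (addF : additive_functor F).

Definition map_complex (C : complex A) : complex B.
Proof.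
exists (fun n => F (C n)) (fun n => fmap F (cdiff C n)) => n.
by rewrite -fmapM cdiff_cdiff fmap0.
Defined.

Definition map_chain_map (C D : complex A) (f : chain_map C D) :
  chain_map (map_complex C) (map_complex D).
Proof.
by exists (fun n => fmap F (f n)) => n; rewrite /= -!fmapM cmap_comm.
Defined.

Lemma map_homotopic (C D : complex A) (f g : chain_map C D) :
  homotopic f g -> homotopic (map_chain_map f) (map_chain_map g).
Proof.
move=> [s [s0 sS]]; exists (fun n => fmap F (s n)); split=> [|n] /=.
  by rewrite s0 addF fmapM.
by rewrite sS !addF !fmapM.
Qed.

End FunctorComplex.

Section Homology.
Variable A : abelian_category.

Definition zero_obj : A := sval (cid (has_zero (ab_axioms A))).
Lemma zero_objP : is_zero zero_obj.
Proof. exact: svalP (cid _). Qed.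

Definition ker X Y (f : @hom A X Y) : A :=
  sval (cid (has_kernels (ab_axioms A) f)).
Definition ker_in X Y (f : @hom A X Y) : hom (ker f) X :=
  sval (cid (svalP (cid (has_kernels (ab_axioms A) f)))).
Lemma ker_inP X Y (f : @hom A X Y) : is_kernel f (ker_in f).
Proof. exact: svalP (cid _). Qed.

Definition coker X Y (f : @hom A X Y) : A :=
  sval (cid (has_cokernels (ab_axioms A) f)).
Definition coker_out X Y (f : @hom A X Y) : hom Y (coker f) :=
  sval (cid (svalP (cid (has_cokernels (ab_axioms A) f)))).
Lemma coker_outP X Y (f : @hom A X Y) : is_cokernel f (coker_out f).
Proof. exact: svalP (cid _). Qed.

Lemma ker_lift_ex X Y W (f : @hom A X Y) (h : hom W X) :
  f ∘ h = 0 -> exists u : hom W (ker f), ker_in f ∘ u = h.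
Proof. by move=> /(ker_inP f).2[u [uP _]]; exists u. Qed.

Lemma coker_desc_ex X Y W (f : @hom A X Y) (h : hom Y W) :
  h ∘ f = 0 -> exists u : hom (coker f) W, u ∘ coker_out f = h.
Proof. by move=> /(coker_outP f).2[u [uP _]]; exists u. Qed.

(* The differential out of degree n; a complex is extended by 0 in degree -1. *)
Definition cprev (C : complex A) (n : nat) : A :=
  if n is m.+1 then C m else zero_obj.
Definition cout (C : complex A) (n : nat) : hom (C n) (cprev C n) :=
  match n return hom (C n) (cprev C n) with
  | 0 => 0
  | m.+1 => cdiff C m
  end.

Lemma cout_cdiff (C : complex A) n : cout C n ∘ cdiff C n = 0.
Proof. by case: n => [|n] /=; rewrite ?mcomp0m ?cdiff_cdiff. Qed.

Definition cycles (C : complex A) n : A := ker (cout C n).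
Definition cycles_in (C : complex A) n : hom (cycles C n) (C n) :=
  ker_in (cout C n).
Definition boundary (C : complex A) n : hom (C n.+1) (cycles C n) :=
  sval (cid (ker_lift_ex (cout_cdiff C n))).
Definition homology (C : complex A) n : A := coker (boundary C n).
Definition homology_proj (C : complex A) n : hom (cycles C n) (homology C n) :=
  coker_out (boundary C n).

Lemma boundaryP (C : complex A) n : cycles_in C n ∘ boundary C n = cdiff C n.
Proof. exact: svalP (cid (ker_lift_ex (cout_cdiff C n))). Qed.

Lemma cycles_in_mono (C : complex A) n : mono (cycles_in C n).
Proof. exact: kernel_mono (ker_inP (cout C n)). Qed.

Lemma homology_proj_epi (C : complex A) n : epi (homology_proj C n).
Proof. exact: cokernel_epi (coker_outP (boundary C n)). Qed.

Section HomologyMap.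
Variables (C D : complex A) (f : chain_map C D).

Lemma cycles_map_subproof n : cout D n ∘ (f n ∘ cycles_in C n) = 0.
Proof.
case: n => [|n] /=; first by rewrite mcomp0m.
by rewrite mcompA cmap_comm -mcompA (ker_inP (cout C n.+1)).1 mcompm0.
Qed.

Definition cycles_map n : hom (cycles C n) (cycles D n) :=
  sval (cid (ker_lift_ex (cycles_map_subproof n))).

Lemma cycles_mapP n : cycles_in D n ∘ cycles_map n = f n ∘ cycles_in C n.
Proof. exact: svalP (cid (ker_lift_ex (cycles_map_subproof n))). Qed.

Lemma homology_map_subproof n :
  (homology_proj D n ∘ cycles_map n) ∘ boundary C n = 0.
Proof.
have -> : homology_proj D n ∘ cycles_map n ∘ boundary C n =
          homology_proj D n ∘ (boundary D n ∘ f n.+1).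
  rewrite -mcompA; congr (_ ∘ _); apply: (@cycles_in_mono D n).
  by rewrite !mcompA cycles_mapP boundaryP -mcompA boundaryP cmap_comm.
by rewrite mcompA (coker_outP _).1 mcomp0m.
Qed.

Definition homology_map n : hom (homology C n) (homology D n) :=
  sval (cid (coker_desc_ex (homology_map_subproof n))).

Lemma homology_mapP n :
  homology_map n ∘ homology_proj C n = homology_proj D n ∘ cycles_map n.
Proof. exact: svalP (cid (coker_desc_ex (homology_map_subproof n))). Qed.

End HomologyMap.

Lemma homology_map1 C n : homology_map (id_chain_map C) n = idm (homology C n).
Proof.
apply: (@homology_proj_epi C n); rewrite homology_mapP mcomp1m.
rewrite -[RHS]mcompm1; congr (_ ∘ _).
by apply: (@cycles_in_mono C n); rewrite cycles_mapP /= mcompm1 mcomp1m.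
Qed.

Lemma homology_mapM C D E (g : chain_map D E) (f : chain_map C D) n :
  homology_map (comp_chain_map g f) n = homology_map g n ∘ homology_map f n.
Proof.
apply: (@homology_proj_epi C n); rewrite -mcompA !homology_mapP mcompA.
rewrite homology_mapP -mcompA; congr (_ ∘ _); apply: (@cycles_in_mono E n).
by rewrite cycles_mapP mcompA cycles_mapP -!mcompA cycles_mapP.
Qed.

Lemma homology_map_homotopic C D (f g : chain_map C D) n :
  homotopic f g -> homology_map f n = homology_map g n.
Proof.
move=> [s [s0 sS]].
have [t tP] : exists t, f n = g n + (cdiff D n ∘ s n + t ∘ cout C n).
  case: n => [|n]; last by exists (s n); exact: sS.
  by exists 0; rewrite mcomp0m addr0.
apply: (@homology_proj_epi C n); rewrite !homology_mapP.
have -> : cycles_map f n = cycles_map g n + boundary D n ∘ (s n ∘ cycles_in C n).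
  apply: (@cycles_in_mono D n); rewrite mcompDr !cycles_mapP tP !mcompDl.
  rewrite mcompA boundaryP -[t ∘ _ ∘ _]mcompA (ker_inP (cout C n)).1 mcompm0.
  by rewrite addr0 mcompA.
by rewrite mcompDr [X in _ + X]mcompA (coker_outP _).1 mcomp0m addr0.
Qed.

End Homology.

Section ProjectiveResolution.
Variables (A : abelian_category) (epA : enough_projectives A).

Lemma projective_resolution_exists (X : A) :
  exists (P : complex A) (e : hom (P 0) X), is_projective_resolution e.
Proof.
pose cov Y := cid (epA Y).
pose p Y : hom (sval (cov Y)) Y := sval (cid (svalP (cov Y))).
have pP Y : projective_obj (sval (cov Y)) /\ epi (p Y).
  exact: svalP (cid (svalP (cov Y))).
pose syz n := iter n (fun Y => ker (p Y)) X.
pose d n : hom (sval (cov (syz n.+1))) (sval (cov (syz n))) :=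
  ker_in (p (syz n)) ∘ p (syz n.+1).
have dd n : d n ∘ d n.+1 = 0.
  by rewrite /d -mcompA [p _ ∘ _]mcompA (ker_inP _).1 mcomp0m mcompm0.
exists (Complex dd), (p X); split=> [n||| n] //=.
- exact: (pP _).1.
- exact: (pP _).2.
- exists (ker (p X)), (p (syz 1)), (ker_in (p X)); split=> //.
    exact: (pP _).2.
  exact: ker_inP.
exists (syz n.+2), (p (syz n.+2)), (ker_in (p (syz n.+1))); split=> //.
  exact: (pP _).2.
have [k0 kU] := ker_inP (p (syz n.+1)).
split=> [|W h dh0]; first by rewrite /d -mcompA k0 mcompm0.
apply: kU; apply: (kernel_mono (ker_inP (p (syz n)))).
by rewrite mcompm0 mcompA.
Qed.

Definition pres (X : A) : complex A :=
  sval (cid (projective_resolution_exists X)).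
Definition pres_aug (X : A) : hom (pres X 0) X :=
  sval (cid (svalP (cid (projective_resolution_exists X)))).
Lemma presP (X : A) : is_projective_resolution (pres_aug X).
Proof. exact: svalP (cid (svalP (cid (projective_resolution_exists X)))). Qed.

Definition pres_map (X Y : A) (f : hom X Y) : chain_map (pres X) (pres Y) :=
  sval (cid (comparison_exists f (presP X) (presP Y))).
Lemma pres_mapP (X Y : A) (f : hom X Y) :
  pres_aug Y ∘ pres_map f 0 = f ∘ pres_aug X.
Proof. exact: svalP (cid (comparison_exists f (presP X) (presP Y))). Qed.

End ProjectiveResolution.

Section DerivedFunctors.

Section Left.
Variables (A B : abelian_category) (epA : enough_projectives A).
Variables (F : functor A B) (addF : additive_functor F).

Definition left_derived_nat (n : nat) : functor A B.
Proof.
exists (fun X => homology (map_complex addF (pres epA X)) n)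
  (fun X Y f => homology_map (map_chain_map addF (pres_map epA f)) n).
- move=> X; rewrite -homology_map1; apply: homology_map_homotopic.
  have [|s [s0 sS]] := comparison_homotopic
    (phi := pres_map epA (idm X)) (psi := id_chain_map _)
    (presP epA X) (presP epA X).
    by rewrite pres_mapP /= mcomp1m mcompm1.
  exists (fun n => fmap F (s n)); split=> [|m] /=.
    by rewrite s0 addF fmapM /= fmap1.
  by rewrite sS !addF !fmapM /= fmap1.
- move=> X Y Z g f; rewrite -homology_mapM; apply: homology_map_homotopic.
  have [|s [s0 sS]] := comparison_homotopic
    (phi := pres_map epA (g ∘ f))
    (psi := comp_chain_map (pres_map epA g) (pres_map epA f))
    (presP epA X) (presP epA Z).
    by rewrite /= mcompA !pres_mapP -!mcompA pres_mapP.
  exists (fun n => fmap F (s n)); split=> [|m] /=.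
    by rewrite s0 addF /= !fmapM.
  by rewrite sS !addF /= !fmapM.
Defined.

(* L_i F for an integer i; it is zero for i < 0. *)
Definition left_derived (i : int) : functor A B :=
  match i with
  | Posz n => left_derived_nat n
  | Negz _ => const_zero_functor A (zero_objP B)
  end.

End Left.

(* R^i G is (L_i G^op)^op: a projective resolution in the opposite category is
   an injective resolution, and homology there (cokernel of a map into a kernel)
   is cohomology here (kernel of a map out of a cokernel). *)
Definition right_derived (A B : abelian_category) (eiB : enough_injectives B)
    (G : functor B A) (addG : additive_functor G) (i : int) : functor B A :=
  unop_functor
    (@left_derived (op_abelian_category B) (op_abelian_category A)
       (op_enough_projectives eiB) (op_functor G)
       (fun X Y f g => addG Y X f g) i).

End DerivedFunctors.

Section Subcategories.

Definition full_subcategory (A : category) (P : A -> Prop) : category :=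
  @Category {X : A | P X} (fun X Y => hom (sval X) (sval Y))
    (fun X => idm (sval X)) (fun X Y Z g f => g ∘ f)
    (fun W X Y Z h g f => mcompA h g f)
    (fun X Y f => mcomp1m f) (fun X Y f => mcompm1 f)
    (fun X Y Z g h f => mcompDl g h f) (fun X Y Z g f h => mcompDr g f h).

Definition restrict_functor (A B : category) (F : functor A B)
    (P : A -> Prop) (Q : B -> Prop) (PQ : forall X, P X -> Q (F X)) :
    functor (full_subcategory P) (full_subcategory Q) :=
  @Functor (full_subcategory P) (full_subcategory Q)
    (fun X => exist Q (F (sval X)) (PQ _ (svalP X)))
    (fun X Y f => @fmap _ _ F (sval X) (sval Y) f)
    (fun X => fmap1 F (sval X)) (fun X Y Z g f => fmapM F g f).

Definition adjoint_equivalence (A B : category)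
    (F : functor A B) (G : functor B A) : Prop :=
  exists adj : adjunction F G,
    (forall X, is_iso (unit adj X)) /\ (forall Y, is_iso (counit adj Y)).

End Subcategories.

Section Tilting.
Variables (A B : abelian_category).
Variables (epA : enough_projectives A) (eiB : enough_injectives B).
Variables (F : functor A B) (G : functor B A) (adj : adjunction F G).

(* Adjoint functors between abelian categories are automatically additive. *)
Definition LF (i : int) : functor A B :=
  left_derived epA (left_adjoint_additive adj) i.
Definition RG (i : int) : functor B A :=
  right_derived eiB (right_adjoint_additive adj) i.

Definition F_acyclic (X : A) : Prop := forall i : int, 0 < i -> is_zero (LF i X).
Definition G_acyclic (Y : B) : Prop := forall i : int, 0 < i -> is_zero (RG i Y).

Definition finite_homological_dimension : Prop :=
  exists d : int, 0 <= d /\ forall X, is_zero (LF d X).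
Definition finite_cohomological_dimension : Prop :=
  exists d : int, 0 <= d /\ forall Y, is_zero (RG d Y).

Record tilting_adjunction : Prop := TiltingAdjunction {
  TA1 : forall P : A, projective_obj P ->
    G_acyclic (F P) /\ is_iso (unit adj P);
  TA2 : finite_cohomological_dimension;
  TA3 : forall I : B, injective_obj I ->
    F_acyclic (G I) /\ is_iso (counit adj I);
  TA4 : finite_homological_dimension
}.

Definition F_concentrated (l : int) (X : A) : Prop :=
  forall i : int, i <> l -> is_zero (LF i X).
Definition G_concentrated (l : int) (Y : B) : Prop :=
  forall i : int, i <> l -> is_zero (RG i Y).

End Tilting.

(* Main.v *)
Require Import Defs.
From mathcomp Require Import all_boot all_order all_algebra.
From mathcomp Require Import boolp zify.
(* The vector-space notion [hom] of all_algebra shadows that of Defs. *)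
Import Defs.

(* Let Y be concentrated in degree l, let I be an injective resolution of Y and
   let H = R^l G(Y) be the only cohomology of G I.  Beyond degree l the complex
   G I is exact, and as its terms are F-acyclic and F has finite homological
   dimension, dimension shifting shows that its cocycles in degrees >= l are
   F-acyclic.  Hence G I^0 -> ... -> G I^(l-1) -> Z^l(G I) is a finite F-acyclic
   resolution of H, so it computes the L_i F(H); but F turns it, through the
   counit, into I^0 -> ... -> I^(l-1) -> Z^l(I), whose only homology is Y.  This
   gives a natural isomorphism L_l F(R^l G(Y)) -> Y, and the dual argument gives
   the other one.

   Vanishing of derived functors is tested against injective objects J of B:
   L_n F(X) = 0 if and only if Hom(P, G J) is exact in degree n for a projective
   resolution P of X.  The long exact sequences that are needed are read off
   from mapping cones. *)

Set Implicit Arguments.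
Unset Strict Implicit.
Unset Printing Implicit Defensive.

Import GRing.Theory.
Local Open Scope ring_scope.

(** * Abelian categories and injective tests *)

(** Only the half using (TA3) and (TA4) is proved directly; the other one is its instance for the
    opposite adjunction. The two parts of concentration play different roles: vanishing of R^i G(Y)
    for i > l makes the cocycles of G I acyclic, while vanishing for i < l makes the truncation a
    resolution of H. The n-th term of that resolution lies in cohomological degree l - n, which
    becomes negative, so I is extended by zero to all integers. For l < 0 there is no truncation,
    and instead every concentrated object is shown to be zero. A comparison map from a projective
    resolution of H to the truncation is a choice, unique only up to homotopy; this suffices for
    naturality after passing to homology. The isomorphisms of the two halves arise independently of
    each other, so the triangle identities have to be enforced at the end. *)

Section Basics.
Variable A : category.

Lemma mcompBl (X Y Z : A) (g h : hom Y Z) (f : hom X Y) :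
  (g - h) ∘ f = g ∘ f - h ∘ f.
Proof. by rewrite mcompDl mcompNl. Qed.

Lemma mcompBr (X Y Z : A) (g : hom Y Z) (f h : hom X Y) :
  g ∘ (f - h) = g ∘ f - g ∘ h.
Proof. by rewrite mcompDr mcompNr. Qed.

Lemma mono0P (X Y : A) (f : hom X Y) :
  (forall W (x : hom W X), f ∘ x = 0 -> x = 0) -> mono f.
Proof.
move=> f0 W g h fgh; apply/eqP; rewrite -subr_eq0; apply/eqP/f0.
by rewrite mcompBr fgh subrr.
Qed.

Lemma mono_eq0 (X Y W : A) (f : hom X Y) (x : hom W X) :
  mono f -> f ∘ x = 0 -> x = 0.
Proof. by move=> mf fx; apply: mf; rewrite fx mcompm0. Qed.

Lemma epi0P (X Y : A) (f : hom X Y) :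
  (forall W (x : hom Y W), x ∘ f = 0 -> x = 0) -> epi f.
Proof.
move=> f0 W g h fgh; apply/eqP; rewrite -subr_eq0; apply/eqP/f0.
by rewrite mcompBl fgh subrr.
Qed.

Lemma epi_eq0 (X Y W : A) (f : hom X Y) (x : hom Y W) :
  epi f -> x ∘ f = 0 -> x = 0.
Proof. by move=> ef xf; apply: ef; rewrite xf mcomp0m. Qed.

Lemma epi_comp (X Y Z : A) (f : hom X Y) (g : hom Y Z) :
  epi f -> epi g -> epi (g ∘ f).
Proof. by move=> ef eg W u v; rewrite !mcompA => /ef/eg. Qed.

Lemma mono_comp (X Y Z : A) (f : hom X Y) (g : hom Y Z) :
  mono f -> mono g -> mono (g ∘ f).
Proof. by move=> mf mg W u v; rewrite -!mcompA => /mg/mf. Qed.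

Lemma iso_mono (X Y : A) (f : hom X Y) : is_iso f -> mono f.
Proof.
by move=> [g [gf _]] W u v /(congr1 (mcomp g)); rewrite !mcompA gf !mcomp1m.
Qed.

Lemma iso_epi (X Y : A) (f : hom X Y) : is_iso f -> epi f.
Proof.
move=> [g [_ fg]] W u v /(congr1 (fun h => h ∘ g)).
by rewrite -!mcompA fg !mcompm1.
Qed.

Lemma iso_id (X : A) : is_iso (idm X).
Proof. by exists (idm X); rewrite mcomp1m. Qed.

Lemma iso_comp (X Y Z : A) (f : hom X Y) (g : hom Y Z) :
  is_iso f -> is_iso g -> is_iso (g ∘ f).
Proof.
move=> [f' [f1 f2]] [g' [g1 g2]]; exists (f' ∘ g'); split.
  by rewrite mcompA -(mcompA f') g1 mcompm1.
by rewrite mcompA -(mcompA g) f2 mcompm1.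
Qed.

Lemma zero_idP (X : A) : idm X = 0 -> is_zero X.
Proof.
move=> X0; split=> Y f.
  by rewrite -[f]mcompm1 X0 mcompm0.
by rewrite -[f]mcomp1m X0 mcomp0m.
Qed.

Lemma zero_id (X : A) : is_zero X -> idm X = 0.
Proof. by move=> [X0 _]; exact: X0. Qed.

Lemma zero_iso (X Y : A) (f : hom X Y) : is_zero X -> is_zero Y -> is_iso f.
Proof.
by move=> X0 Y0; exists 0; rewrite mcompm0 mcomp0m !zero_id.
Qed.

Lemma iso_is_zero (X Y : A) (f : hom X Y) : is_iso f -> is_zero X -> is_zero Y.
Proof.
move=> [g [_ fg]] X0; apply: zero_idP.
by rewrite -fg (X0.1 _ f) mcomp0m.
Qed.

Lemma zero_injective (X : A) : is_zero X -> injective_obj X.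
Proof. by move=> X0 Y Z m f _; exists 0; rewrite mcomp0m (X0.2 _ f). Qed.

End Basics.

Section AbelianBasics.
Variable A : abelian_category.

Lemma mono_epi_iso (X Y : A) (f : hom X Y) : mono f -> epi f -> is_iso f.
Proof.
move=> mf ef; have [Z [g [gf univ]]] := mono_is_kernel (ab_axioms A) mf.
have g0 : g = 0 by apply: epi_eq0 ef gf.
have [|u [fu _]] := univ _ (idm Y); first by rewrite g0 mcomp0m.
exists u; split=> //; apply: mf.
by rewrite mcompA fu mcompm1 mcomp1m.
Qed.

(** The epimorphism is a cokernel of some [w]; as [w] factors through [k], whatever kills [k] kills
    [w]. *)
Lemma epi_kernel_cokernel (X Y K : A) (e : hom X Y) (k : hom K X) :
  epi e -> is_kernel e k -> is_cokernel k e.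
Proof.
move=> ee [ek kU]; split=> // W h hk.
have [V [w [ew wU]]] := epi_is_cokernel (ab_axioms A) ee.
have [z [kz _]] := kU _ _ ew.
by apply: wU; rewrite -kz mcompA hk mcomp0m.
Qed.

(** If [m] kills [x], with cokernel [q], then [g] factors through [q ∘ c]. A morphism [y] with
    cokernel [q ∘ c] then factors through [k] and is killed by [c], so [c] factors through [q ∘ c];
    hence [q] has a left inverse and [x = 0]. *)
Lemma coimage_mono (X Y K Q : A) (g : hom X Y) (k : hom K X) (c : hom X Q)
    (m : hom Q Y) :
  is_kernel g k -> is_cokernel k c -> m ∘ c = g -> mono m.
Proof.
move=> kK cC mc; have ec := cokernel_epi cC; apply: mono0P => W x mx.
have [Q' [q qC]] := has_cokernels (ab_axioms A) x.
have [m' [m'q _]] := qC.2 _ _ mx.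
have [V [y yC]] := epi_is_cokernel (ab_axioms A) (epi_comp ec (cokernel_epi qC)).
have [z [kz _]] : exists! z, k ∘ z = y.
  by apply: kK.2; rewrite -mc -m'q -!mcompA (mcompA q) yC.1 mcompm0.
have [r [rq _]] : exists! r, r ∘ (q ∘ c) = c.
  by apply: yC.2; rewrite -kz mcompA cC.1 mcomp0m.
have {}rq : r ∘ q = idm Q by apply: ec; rewrite mcomp1m -mcompA.
by rewrite -[x]mcomp1m -rq -mcompA qC.1 mcompm0.
Qed.

(** A map vanishing on the kernel of [g] descends to the coimage, a subobject of [Y], from which it
    extends to [Y]. *)
Lemma injective_ker_factor (X Y K J : A) (g : hom X Y) (k : hom K X)
    (h : hom X J) :
  injective_obj J -> is_kernel g k -> h ∘ k = 0 -> exists u, h = u ∘ g.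
Proof.
move=> injJ kK hk.
have [Q [c cC]] := has_cokernels (ab_axioms A) k.
have [m [mc _]] := cC.2 _ _ kK.1.
have [h' [h'c _]] := cC.2 _ _ hk.
have [u um] := injJ _ _ m h' (coimage_mono kK cC mc).
by exists u; rewrite -mc mcompA um.
Qed.

End AbelianBasics.

Section InjectiveTests.
Variables (B : abelian_category) (eiB : enough_injectives B).

Lemma mono_injective_test (X Y : B) (f : hom X Y) :
  (forall (J : B) (u : hom X J), injective_obj J -> exists v, v ∘ f = u) ->
  mono f.
Proof.
move=> ext; have [J [m [injJ mm]]] := eiB X.
have [v vf] := ext J m injJ => W g h fgh.
by apply: mm; rewrite -vf -!mcompA fgh.
Qed.

Lemma epi_injective_test (X Y : B) (f : hom X Y) :
  (forall (J : B) (u : hom Y J), injective_obj J -> u ∘ f = 0 -> u = 0) ->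
  epi f.
Proof.
move=> f0; apply: epi0P => W x xf; have [J [m [injJ mm]]] := eiB W.
by apply: (mono_eq0 mm); apply: f0 => //; rewrite -mcompA xf mcompm0.
Qed.

Lemma zero_injective_test (X : B) :
  (forall (J : B) (u : hom X J), injective_obj J -> u = 0) -> is_zero X.
Proof.
move=> X0; have [J [m [injJ mm]]] := eiB X.
by apply: zero_idP; apply: mm; rewrite mcompm0 mcompm1; exact: X0.
Qed.

(** [Hom(-, J)] is exact for injective [J], and maps to injectives detect zero objects. *)
Lemma homology_zeroP (C : complex B) n :
  is_zero (homology C n) <->
  forall (J : B) (u : hom (C n) J), injective_obj J ->
    u ∘ cdiff C n = 0 -> exists v : hom (cprev C n) J, u = v ∘ cout C n.
Proof.
split=> [H0 J u injJ ud|test].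
  apply: injective_ker_factor injJ (ker_inP (cout C n)) _.
  have [w <-] : exists w, w ∘ homology_proj C n = u ∘ cycles_in C n.
    by apply: coker_desc_ex; rewrite -mcompA boundaryP.
  by rewrite (H0.1 _ w) mcomp0m.
apply: zero_injective_test => J u injJ.
have [v vP] := injJ _ _ _ (u ∘ homology_proj C n) (@cycles_in_mono _ C n).
have [|w wP] := test J v injJ.
  by rewrite -boundaryP mcompA vP -mcompA (coker_outP _).1 mcompm0.
apply: (epi_eq0 (@homology_proj_epi _ C n)); rewrite -vP wP -mcompA.
by rewrite (ker_inP _).1 mcompm0.
Qed.

(* A chain map inducing isomorphisms on the cohomology of Hom(-, J) for all
   injective J is a homology isomorphism. *)
Lemma homology_map_iso_test (C D : complex B) (f : chain_map C D) n :
  (forall (J : B) (u : hom (C n) J), injective_obj J -> u ∘ cdiff C n = 0 ->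
     exists (g : hom (D n) J) (v : hom (cprev C n) J),
       g ∘ cdiff D n = 0 /\ u = g ∘ f n + v ∘ cout C n) ->
  (forall (J : B) (g : hom (D n) J) (v : hom (cprev C n) J), injective_obj J ->
     g ∘ cdiff D n = 0 -> g ∘ f n = v ∘ cout C n ->
     exists w : hom (cprev D n) J, g = w ∘ cout D n) ->
  is_iso (homology_map f n).
Proof.
move=> surj inj; apply: mono_epi_iso.
- apply: mono_injective_test => J u injJ.
  have [v vP] := injJ _ _ _ (u ∘ homology_proj C n) (@cycles_in_mono _ C n).
  have [|g [w [gd vE]]] := surj J v injJ.
    by rewrite -boundaryP mcompA vP -mcompA (coker_outP _).1 mcompm0.
  have [h hP] : exists h, h ∘ homology_proj D n = g ∘ cycles_in D n.
    by apply: coker_desc_ex; rewrite -mcompA boundaryP.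
  exists h; apply: (@homology_proj_epi _ C n).
  rewrite -mcompA homology_mapP mcompA hP -mcompA cycles_mapP -vP vE mcompDl.
  by rewrite -!mcompA (ker_inP _).1 mcompm0 addr0.
- apply: epi_injective_test => J u injJ uf.
  have [g gP] := injJ _ _ _ (u ∘ homology_proj D n) (@cycles_in_mono _ D n).
  have gd : g ∘ cdiff D n = 0.
    by rewrite -boundaryP mcompA gP -mcompA (coker_outP _).1 mcompm0.
  have [v vP] : exists v, g ∘ f n = v ∘ cout C n.
    apply: injective_ker_factor injJ (ker_inP (cout C n)) _.
    rewrite -mcompA -cycles_mapP mcompA gP -mcompA -homology_mapP mcompA uf.
    by rewrite mcomp0m.
  have [w wP] := inj J g v injJ gd vP.
  apply: (epi_eq0 (@homology_proj_epi _ D n)); rewrite -gP wP -mcompA.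
  by rewrite (ker_inP _).1 mcompm0.
Qed.

End InjectiveTests.

(** * Projective resolutions and mapping cones *)

(* Exactness tested on generalized elements with projective domain. *)
Definition pexact (A : category) (X Y Z : A) (f : hom X Y) (g : hom Y Z) :
    Prop :=
  g ∘ f = 0 /\
  forall (Q : A) (h : hom Q Y), projective_obj Q -> g ∘ h = 0 ->
    exists u, f ∘ u = h.

Lemma exact_pexact (A : category) (X Y Z : A) (f : hom X Y) (g : hom Y Z) :
  exact f g -> pexact f g.
Proof.
move=> fg; split=> [|Q h projQ gh]; first exact: exact_comp0.
exact: exact_lift projQ fg gh.
Qed.

Section Resolutions.
Variables (A : abelian_category) (epA : enough_projectives A).

Lemma epi_projective_test (X Y : A) (f : hom X Y) :
  (forall (Q : A) (h : hom Q Y), projective_obj Q -> exists u, f ∘ u = h) ->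
  epi f.
Proof.
move=> ext; have [Q [p [projQ ep]]] := epA Y.
have [u fu] := ext Q p projQ => W g h gfh.
by apply: ep; rewrite -fu !mcompA gfh.
Qed.

Lemma pexact_exact (X Y Z : A) (f : hom X Y) (g : hom Y Z) :
  pexact f g -> exact f g.
Proof.
move=> [gf lift]; have [e ke] := ker_lift_ex gf.
exists (ker g), e, (ker_in g); split=> //; last exact: ker_inP.
apply: epi_projective_test => Q h projQ.
have [|u fu] := lift Q (ker_in g ∘ h) projQ.
  by rewrite mcompA (ker_inP g).1 mcomp0m.
exists u; apply: (kernel_mono (ker_inP g)).
by rewrite mcompA ke.
Qed.

(* The comparison theorem for a target that is exact, not necessarily
   projective. *)
Lemma pexact_comparison_exists (X Y : A) (P T : complex A)
    (eP : hom (P 0) X) (eT : hom (T 0) Y) (f : hom X Y) :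
  is_projective_resolution eP -> epi eT -> pexact (cdiff T 0) eT ->
  (forall n, pexact (cdiff T n.+1) (cdiff T n)) ->
  exists phi : chain_map P T, eT ∘ phi 0 = f ∘ eP.
Proof.
move=> [projP _ exP0 exP] epiT [_ exT0] exT.
have [u0 u0P] := projP 0 _ _ eT (f ∘ eP) epiT.
have [u1 u1P] : exists u, cdiff T 0 ∘ u = u0 ∘ cdiff P 0.
  apply: exT0 (projP 1) _.
  by rewrite mcompA u0P -mcompA (exact_comp0 exP0) mcompm0.
(* The recursion carries two consecutive components and their commutation, from which the next
   component is lifted. *)
pose S n := {uv : hom (P n) (T n) * hom (P n.+1) (T n.+1) |
              cdiff T n ∘ uv.2 = uv.1 ∘ cdiff P n}.
have step n (s : S n) : {w | cdiff T n.+1 ∘ w = (sval s).2 ∘ cdiff P n.+1}.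
  apply: cid; apply: (exT n).2 (projP _) _.
  by case: s => -[u v] /= uvP; rewrite mcompA uvP -mcompA cdiff_cdiff mcompm0.
pose st := fix st n : S n :=
  if n is m.+1 return S n then
    exist _ ((sval (st m)).2, sval (step m (st m))) (svalP (step m (st m)))
  else exist _ (u0, u1) u1P : S 0.
by exists (@ChainMap A P T (fun n => (sval (st n)).1) (fun n => svalP (st n))).
Qed.

Lemma pexact_comparison_homotopic (X Y : A) (P T : complex A)
    (eP : hom (P 0) X) (eT : hom (T 0) Y) (phi psi : chain_map P T) :
  is_projective_resolution eP -> pexact (cdiff T 0) eT ->
  (forall n, pexact (cdiff T n.+1) (cdiff T n)) ->
  eT ∘ phi 0 = eT ∘ psi 0 -> homotopic phi psi.
Proof.
move=> [projP _ _ _] [_ exT0] exT eqe.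
pose d n := phi n - psi n.
have dP n : cdiff T n ∘ d n.+1 = d n ∘ cdiff P n.
  by rewrite mcompBr mcompBl !cmap_comm.
have [s0 s0P] : exists s, cdiff T 0 ∘ s = d 0.
  by apply: exT0 (projP 0) _; rewrite mcompBr eqe subrr.
have [s1 s1P] : exists s, cdiff T 1 ∘ s = d 1 - s0 ∘ cdiff P 0.
  apply: (exT 0).2 (projP 1) _.
  by rewrite mcompBr mcompA s0P dP subrr.
pose S n := {uv : hom (P n) (T n.+1) * hom (P n.+1) (T n.+2) |
              cdiff T n.+1 ∘ uv.2 = d n.+1 - uv.1 ∘ cdiff P n}.
have step n (s : S n) :
    {w | cdiff T n.+2 ∘ w = d n.+2 - (sval s).2 ∘ cdiff P n.+1}.
  apply: cid; apply: (exT n.+1).2 (projP _) _.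
  case: s => -[u v] /= uvP; rewrite mcompBr mcompA uvP dP mcompBl.
  by rewrite -mcompA cdiff_cdiff mcompm0 subr0 subrr.
pose st := fix st n : S n :=
  if n is m.+1 return S n then
    exist _ ((sval (st m)).2, sval (step m (st m))) (svalP (step m (st m)))
  else exist _ (s0, s1) s1P : S 0.
exists (fun n => (sval (st n)).1); split=> [|n].
  by rewrite /= s0P addrC subrK.
have E : cdiff T n.+1 ∘ (sval (st n.+1)).1 = _ := svalP (st n).
by rewrite E subrK addrC subrK.
Qed.

End Resolutions.

Section Ext.
Variables (A : abelian_category) (epA : enough_projectives A).

(* Vanishing of the n-th cohomology of the complex Hom(C, W). *)
Definition cohom_zero (C : complex A) (W : A) (n : nat) : Prop :=
  forall u : hom (C n) W, u ∘ cdiff C n = 0 ->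
  exists v : hom (cprev C n) W, u = v ∘ cout C n.

(** [Ext^n(X, W) = 0]; since [cout] is zero in degree 0, the case [n = 0] says [Hom(X, W) = 0]. *)
Definition Ext_zero (X W : A) (n : nat) : Prop :=
  cohom_zero (pres epA X) W n.

Lemma cout_cmap (C D : complex A) (f : chain_map C D) n :
  exists f' : hom (cprev C n) (cprev D n), cout D n ∘ f n = f' ∘ cout C n.
Proof.
case: n => [|n]; last by exists (f n); exact: cmap_comm.
by exists 0; rewrite /= mcomp0m mcomp0m.
Qed.

(** Two resolutions are homotopy equivalent: a cocycle [u] is cohomologous to [u ∘ phi ∘ psi], and
    [u ∘ phi] is a coboundary on [P]. *)
Lemma cohom_zero_resolution (X W : A) (P Q : complex A) (eP : hom (P 0) X)
    (eQ : hom (Q 0) X) n :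
  is_projective_resolution eP -> is_projective_resolution eQ ->
  cohom_zero P W n -> cohom_zero Q W n.
Proof.
move=> PP PQ P0 u ud.
have [phi phiP] := comparison_exists (idm X) PP PQ.
have [psi psiP] := comparison_exists (idm X) PQ PP.
have [|s [s0 sS]] := comparison_homotopic
    (phi := id_chain_map Q) (psi := comp_chain_map phi psi) PQ PQ.
  by rewrite /= mcompA phiP mcomp1m psiP mcomp1m mcompm1.
have [t tP] : exists t, idm (Q n) =
    phi n ∘ psi n + (cdiff Q n ∘ s n + t ∘ cout Q n).
  case: n {P0 u ud} => [|n]; last by exists (s n); exact: sS.
  by exists 0; rewrite mcomp0m addr0.
have [|v vP] := P0 (u ∘ phi n).
  by rewrite -mcompA -cmap_comm mcompA ud mcomp0m.
have [psi' psi'P] := cout_cmap psi n.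
exists (v ∘ psi' + u ∘ t); rewrite mcompDl -!mcompA -psi'P.
rewrite -[LHS]mcompm1 tP !mcompDr !mcompA vP ud mcomp0m add0r.
by rewrite -!mcompA.
Qed.

Lemma Ext_zeroP (X W : A) (P : complex A) (eP : hom (P 0) X) n :
  is_projective_resolution eP -> Ext_zero X W n <-> cohom_zero P W n.
Proof.
move=> PP; split; first exact: cohom_zero_resolution (presP epA X) PP.
exact: cohom_zero_resolution PP (presP epA X).
Qed.

(** For [n > 0], [Ext^(n+1)(X, W)] is [Ext^n(K, W)] with [K] the first syzygy; for [n = 0] already
    [Hom(K, W)] vanishes. *)
Lemma Ext_zeroS (W : A) n :
  (forall X, Ext_zero X W n) -> forall X, Ext_zero X W n.+1.
Proof.
move=> W0 X; have [projP epiP exP0 exP] := presP epA X.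
pose P := pres epA X.
pose Q := @Complex A (fun n => P n.+1) (fun n => cdiff P n.+1)
  (fun n => cdiff_cdiff P n.+1).
have [K [e [k [epie kK dE]]]] := exP0.
have resQ : is_projective_resolution (X := K) (P := Q) e.
  split=> [m|||m]; [exact: projP|exact: epie| |exact: exP].
  have [K' [e' [k' [epie' kK' dE']]]] := exP 0%N.
  exists K', e', k'; split=> //; split=> [|V h eh].
    by apply: (kernel_mono kK); rewrite mcompm0 mcompA -dE kK'.1.
  by apply: kK'.2; rewrite dE -mcompA eh mcompm0.
move=> u ud; have [//|v ->] := (Ext_zeroP W n resQ).1 (W0 K) u.
by case: n {W0 u ud} v => [|n] v; [exists 0; rewrite !mcompm0 mcomp0m|exists v].
Qed.

End Ext.

Section Cone.
Variable A : abelian_category.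

Record biprod (X Y : A) := Biprod {
  bobj :> A;
  inl_b : hom X bobj; inr_b : hom Y bobj;
  prl_b : hom bobj X; prr_b : hom bobj Y;
  biprodP : is_biproduct inl_b inr_b prl_b prr_b
}.

Lemma biprod_exists (X Y : A) : exists _ : biprod X Y, True.
Proof.
have [S [i [j [p [q SP]]]]] := has_biproducts (ab_axioms A) X Y.
by exists (Biprod SP).
Qed.

Definition bsum (X Y : A) : biprod X Y := sval (cid (biprod_exists X Y)).

Section BiprodTheory.
Variables (X Y : A) (S : biprod X Y).

Lemma biprod_hom_eq W (g h : hom S W) :
  g ∘ inl_b S = h ∘ inl_b S -> g ∘ inr_b S = h ∘ inr_b S -> g = h.
Proof.
move=> gl gr; rewrite -[g]mcompm1 -[h]mcompm1 -(biprod_id (biprodP S)).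
by rewrite !mcompDr !mcompA gl gr.
Qed.

Lemma biprod_desc W (g : hom X W) (h : hom Y W) :
  exists f : hom S W, f ∘ inl_b S = g /\ f ∘ inr_b S = h.
Proof.
have [h1 h2 h3 h4 _] := biprodP S.
exists (g ∘ prl_b S + h ∘ prr_b S); rewrite !mcompDl -!mcompA h1 h2 h3 h4.
by rewrite !mcompm1 !mcompm0 addr0 add0r.
Qed.

Lemma biprod_elt W (z : hom W S) :
  z = inl_b S ∘ (prl_b S ∘ z) + inr_b S ∘ (prr_b S ∘ z).
Proof.
by rewrite !mcompA -mcompDl (biprod_id (biprodP S)) mcomp1m.
Qed.

Lemma biprod_elt_eq0 W (x : hom W X) (y : hom W Y) :
  inl_b S ∘ x + inr_b S ∘ y = 0 -> x = 0 /\ y = 0.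
Proof.
have [h1 h2 h3 h4 _] := biprodP S => xy0.
have := congr1 (mcomp (prl_b S)) xy0; have := congr1 (mcomp (prr_b S)) xy0.
rewrite !mcompDr !mcompA h1 h2 h3 h4 !mcomp1m !mcomp0m !mcompm0.
by rewrite add0r addr0.
Qed.

Lemma biprod_projective :
  projective_obj X -> projective_obj Y -> projective_obj S.
Proof.
move=> pX pY U V e f ee.
have [u eu] := pX _ _ e (f ∘ inl_b S) ee.
have [v ev] := pY _ _ e (f ∘ inr_b S) ee.
have [g [gl gr]] := biprod_desc u v.
by exists g; apply: biprod_hom_eq; rewrite -mcompA ?gl ?gr.
Qed.

End BiprodTheory.

Variables (P Q : complex A) (a : chain_map P Q).

(* The mapping cone, in which the component [P n] sits in degree [n.+1]. *)
Definition cone_obj n : A :=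
  if n is m.+1 then bobj (bsum (P m) (Q m.+1)) else Q 0%N.

Definition cone_inr n : hom (Q n) (cone_obj n) :=
  if n is m.+1 then inr_b (bsum (P m) (Q m.+1)) else idm (Q 0%N).

Definition cone_inl n : hom (P n) (cone_obj n.+1) :=
  inl_b (bsum (P n) (Q n.+1)).

(** The cone differential on the summand [P n] of degree [n.+1]; in degree 0 of the target no
    summand of [P] is left, and only [a] remains. *)
Definition cone_dl n : hom (P n) (cone_obj n) :=
  match n return hom (P n) (cone_obj n) with
  | 0 => a 0%N
  | m.+1 => cone_inr m.+1 ∘ a m.+1 - cone_inl m ∘ cdiff P m
  end.

Definition cone_diff n : hom (cone_obj n.+1) (cone_obj n) :=
  cone_dl n ∘ prl_b (bsum (P n) (Q n.+1)) +
  cone_inr n ∘ cdiff Q n ∘ prr_b (bsum (P n) (Q n.+1)).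

Lemma cone_diff_inl n : cone_diff n ∘ cone_inl n = cone_dl n.
Proof.
have [h1 h2 h3 h4 _] := biprodP (bsum (P n) (Q n.+1)).
by rewrite mcompDl -!mcompA h1 h4 mcompm1 !mcompm0 addr0.
Qed.

Lemma cone_diff_inr n : cone_diff n ∘ cone_inr n.+1 = cone_inr n ∘ cdiff Q n.
Proof.
have [h1 h2 h3 h4 _] := biprodP (bsum (P n) (Q n.+1)).
by rewrite mcompDl -!mcompA h2 h3 !mcompm0 mcompm1 add0r.
Qed.

Lemma cone_diff_diff n : cone_diff n ∘ cone_diff n.+1 = 0.
Proof.
apply: biprod_hom_eq; rewrite -mcompA mcomp0m.
  rewrite cone_diff_inl mcompBr !mcompA cone_diff_inr cone_diff_inl.
  rewrite -mcompA cmap_comm; case: n => [|n] /=.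
    by rewrite mcomp1m subrr.
  by rewrite mcompBl -[X in _ - (_ - X)]mcompA cdiff_cdiff mcompm0 subr0
    mcompA subrr.
by rewrite cone_diff_inr mcompA cone_diff_inr -mcompA cdiff_cdiff mcompm0.
Qed.

Definition cone : complex A := Complex cone_diff_diff.

Lemma cone_hom_eq n W (g h : hom (cone n.+1) W) :
  g ∘ cone_inl n = h ∘ cone_inl n -> g ∘ cone_inr n.+1 = h ∘ cone_inr n.+1 ->
  g = h.
Proof. exact: biprod_hom_eq. Qed.

Lemma cone_desc n W (g : hom (P n) W) (h : hom (Q n.+1) W) :
  exists f : hom (cone n.+1) W, f ∘ cone_inl n = g /\ f ∘ cone_inr n.+1 = h.
Proof. exact: biprod_desc. Qed.

Lemma cone_projective n :
  (forall m, projective_obj (P m)) -> (forall m, projective_obj (Q m)) ->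
  projective_obj (cone n).
Proof.
by move=> pP pQ; case: n => [|n] /=; first exact: pQ; apply: biprod_projective.
Qed.

Section ConeExact.
Variables (X Y Z : A) (eP : hom (P 0) X) (eQ : hom (Q 0) Y).
Variables (f : hom X Y) (g : hom Y Z).
Hypotheses (af : eQ ∘ a 0 = f ∘ eP) (mf : mono f) (fg : pexact f g).
Hypotheses (epiP : epi eP) (exP0 : pexact (cdiff P 0) eP).
Hypothesis exP : forall n, pexact (cdiff P n.+1) (cdiff P n).
Hypothesis exQ0 : pexact (cdiff Q 0) eQ.
Hypothesis exQ : forall n, pexact (cdiff Q n.+1) (cdiff Q n).

(** The generality serves twice: a short exact sequence gives a resolution of its cokernel, and
    [f = idm], [g = 0] gives acyclicity of the cone of a comparison map. *)
Lemma cone_exact0 : pexact (cdiff cone 0) (g ∘ eQ).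
Proof.
split.
  apply: cone_hom_eq; rewrite -mcompA mcomp0m.
    by rewrite cone_diff_inl -mcompA af mcompA fg.1 mcomp0m.
  by rewrite cone_diff_inr /= mcomp1m -mcompA exQ0.1 mcompm0.
move=> R y projR; rewrite -mcompA => /fg.2[//|m fm].
have [x ex] := projR _ _ eP m epiP.
have [|y' y'P] := exQ0.2 R (y - a 0 ∘ x) projR.
  by rewrite mcompBr mcompA af -mcompA ex fm subrr.
exists (cone_inl 0 ∘ x + cone_inr 1 ∘ y').
rewrite mcompDr !mcompA cone_diff_inl cone_diff_inr /= mcomp1m y'P.
by rewrite addrC subrK.
Qed.

Lemma cone_exact n : pexact (cdiff cone n.+1) (cdiff cone n).
Proof.
split=> [|R z projR]; first exact: cone_diff_diff.
have [x [y ->]] : exists x y, z = cone_inl n ∘ x + cone_inr n.+1 ∘ y.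
  by do 2!eexists; exact: biprod_elt.
rewrite mcompDr !mcompA cone_diff_inl cone_diff_inr => xy0.
have [x' [x'P x'y]] : exists x', cdiff P n ∘ x' = x /\
    a n ∘ x + cdiff Q n ∘ y = 0.
  case: n x y xy0 {z} => [|n] x y /=; last first.
    rewrite mcompBl -!mcompA addrAC -mcompDr addrC -mcompNr => xy0.
    have [x0 y0] := biprod_elt_eq0 xy0.
    have [|x' x'P] := (exP n).2 R x projR.
      by apply/eqP; rewrite -oppr_eq0; apply/eqP.
    by exists x'; split.
  rewrite mcomp1m => xy0; have [|x' x'P] := exP0.2 R x projR; last by exists x'.
  (* In degree 0 the vanishing of [eP ∘ x] is not a component of the cycle condition; it holds
     because [f] is mono and [eQ] kills the boundary of [y]. *)
  apply: mf; rewrite mcompm0 mcompA -af -mcompA.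
  have := congr1 (mcomp eQ) xy0.
  by rewrite mcompDr (mcompA eQ (cdiff Q 0)) exQ0.1 mcomp0m addr0 mcompm0.
have [|y' y'P] := (exQ n).2 R (y + a n.+1 ∘ x') projR.
  by rewrite mcompDr mcompA cmap_comm -mcompA x'P addrC.
exists (cone_inr n.+2 ∘ y' - cone_inl n.+1 ∘ x').
rewrite mcompBr !mcompA cone_diff_inl cone_diff_inr /= mcompBl -!mcompA y'P x'P.
by rewrite mcompDr opprB addrC [_ ∘ y + _]addrC addrA subrK.
Qed.

End ConeExact.

End Cone.

(** * Vanishing of Ext and acyclic resolutions *)

Section ShortExact.
Variables (A : abelian_category) (epA : enough_projectives A).

Lemma epi_exact_factor (X Y Z W : A) (f : hom X Y) (g : hom Y Z)
    (h : hom Y W) :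
  epi g -> exact f g -> h ∘ f = 0 -> exists u, u ∘ g = h.
Proof.
move=> eg [K [e [k [ee kK ->]]]]; rewrite mcompA => /(epi_eq0 ee) hk.
by have [u [uP _]] := (epi_kernel_cokernel eg kK).2 _ _ hk; exists u.
Qed.

Lemma Ext_zero_iso (X Y W : A) (f : hom X Y) n :
  is_iso f -> Ext_zero epA X W n -> Ext_zero epA Y W n.
Proof.
move=> isof; have [projP epiP [K [e [k [ee kK dE]]]] exP] := presP epA X.
have resY : is_projective_resolution (X := Y) (f ∘ pres_aug epA X).
  split=> //; first exact: epi_comp epiP (iso_epi isof).
  exists K, e, k; split=> //; split; first by rewrite -mcompA kK.1 mcompm0.
  move=> V h fh; apply: kK.2.
  by apply: (mono_eq0 (iso_mono isof)); rewrite mcompA.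
by move/(Ext_zeroP epA W n resY).
Qed.

(** Placed in degree 0, [P] is a projective resolution of itself. *)
Lemma Ext_zero_projective (P W : A) n :
  projective_obj P -> Ext_zero epA P W n.+1.
Proof.
move=> projP; have Z0 := zero_objP A.
pose C := @Complex A (fun n => if n is _.+1 then zero_obj A else P)
  (fun=> 0) (fun n => mcomp0m _ _).
have resC : is_projective_resolution (P := C) (idm P).
  split=> [[|m]||| m].
  - exact: projP.
  - by move=> X Y e f _; exists 0; rewrite mcompm0 (Z0.1 _ f).
  - exact: iso_epi (iso_id P).
  - apply: (pexact_exact epA); split=> [|Q h _]; rewrite ?mcompm0 // mcomp1m.
    by move=> ->; exists 0; rewrite mcompm0.
  apply: (pexact_exact epA); split=> [|Q h _ _]; first by rewrite mcompm0.
  by exists 0; rewrite mcompm0 (Z0.2 _ h).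
by apply/(Ext_zeroP epA W n.+1 resC) => u _; exists 0; rewrite mcomp0m; exact: Z0.1.
Qed.

Section LongExact.
Variables (X Y Z : A) (i : hom X Y) (p : hom Y Z) (W : A).
Hypotheses (mi : mono i) (epip : epi p) (ip : pexact i p).

Let P := pres epA X.
Let Q := pres epA Y.

(* The cone of a lift of a monomorphism i to projective resolutions is a
   projective resolution of the cokernel of i; the long exact sequence of Ext
   is read off from its cochains. *)
Lemma cone_resolution :
  exists2 a : chain_map P Q, pres_aug epA Y ∘ a 0 = i ∘ pres_aug epA X &
    is_projective_resolution (P := cone a) (p ∘ pres_aug epA Y).
Proof.
have RP := presP epA X; have RQ := presP epA Y.
have [a aP] := comparison_exists i RP RQ; exists a => //.
have [pP eP xP0 xP] := RP; have [pQ eQ xQ0 xQ] := RQ.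
split=> [n|||n].
- exact: cone_projective.
- exact: epi_comp.
- apply: (pexact_exact epA).
  exact: (cone_exact0 aP ip eP (exact_pexact xQ0)).
apply: (pexact_exact epA).
apply: (cone_exact aP mi (exact_pexact xP0) _ (exact_pexact xQ0)) => m.
  exact/exact_pexact/xP.
exact/exact_pexact/xQ.
Qed.

(** Exactness of [Ext^(n+1)(Y) -> Ext^(n+1)(X) -> Ext^(n+2)(Z)]: the connecting map extends a
    cocycle on [P] by zero to the cone. *)
Lemma Ext_zero_sub n :
  Ext_zero epA Z W n.+2 -> Ext_zero epA Y W n.+1 -> Ext_zero epA X W n.+1.
Proof.
have [a _ RK] := cone_resolution => /(Ext_zeroP epA W n.+2 RK) Z0 Y0 u ud.
have [u' [u'l u'r]] := cone_desc a (n := n.+1) u 0.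
have [|v vP] := Z0 u'.
  apply: cone_hom_eq; rewrite mcomp0m -mcompA.
    by rewrite cone_diff_inl mcompBr !mcompA u'l u'r mcomp0m sub0r ud oppr0.
  by rewrite cone_diff_inr mcompA u'r mcomp0m.
have [|w wP] := Y0 (v ∘ cone_inr P Q n.+1).
  by rewrite -mcompA -(cone_diff_inr a) mcompA -vP u'r.
exists (w ∘ a n - v ∘ cone_inl P Q n).
rewrite -u'l vP -mcompA cone_diff_inl mcompBr mcompA wP mcompBl.
by rewrite -!mcompA -cmap_comm.
Qed.

(** Exactness of [Ext^(n+1)(Z) -> Ext^(n+1)(Y) -> Ext^(n+1)(X)]: a cocycle [h] on [Q] and a cochain
    [k] bounding [h ∘ a] form a cocycle of the cone. *)
Lemma Ext_zero_mid n :
  Ext_zero epA X W n.+1 -> Ext_zero epA Z W n.+1 -> Ext_zero epA Y W n.+1.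
Proof.
have [a _ RK] := cone_resolution => X0 /(Ext_zeroP epA W n.+1 RK) Z0 h hd.
have [|k kP] := X0 (h ∘ a n.+1).
  by rewrite -mcompA -cmap_comm mcompA hd mcomp0m.
have [u [ul ur]] := cone_desc a k h.
have [|w wP] := Z0 u.
  apply: cone_hom_eq; rewrite mcomp0m -mcompA.
    by rewrite cone_diff_inl mcompBr !mcompA ul ur kP subrr.
  by rewrite cone_diff_inr mcompA ur hd.
exists (w ∘ cone_inr P Q n).
by rewrite -ur wP -mcompA cone_diff_inr mcompA.
Qed.

(** Exactness of [Hom(Y, W) -> Hom(X, W) -> Ext^1(Z, W)]. *)
Lemma Ext_zero_extend (u : hom X W) :
  Ext_zero epA Z W 1 -> exists v : hom Y W, v ∘ i = u.
Proof.
have [_ epiP xP0 _] := presP epA X; have [_ epiQ xQ0 _] := presP epA Y.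
have [a aP RK] := cone_resolution => /(Ext_zeroP epA W 1 RK) Z0.
have [u' [u'l u'r]] := cone_desc a (n := 0) (u ∘ pres_aug epA X) 0.
have [|h hP] := Z0 u'.
  apply: cone_hom_eq; rewrite mcomp0m -mcompA.
    rewrite cone_diff_inl mcompBr !mcompA u'l u'r mcomp0m sub0r -mcompA.
    by rewrite (exact_comp0 xP0) mcompm0 oppr0.
  by rewrite cone_diff_inr mcompA u'r mcomp0m.
have [|v vP] := epi_exact_factor (h := h) epiQ xQ0.
  by rewrite -u'r hP -mcompA cone_diff_inr /= mcomp1m.
exists v; apply: epiP.
by rewrite -mcompA -aP mcompA vP -u'l hP -mcompA cone_diff_inl.
Qed.

End LongExact.
End ShortExact.

(** * Comparison of a projective with an acyclic resolution *)

Section AcyclicResolution.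
Variables (A : abelian_category) (epA : enough_projectives A).
Variables (H : A) (T : complex A) (t : hom (T 0) H).
Hypothesis exT0 : pexact (cdiff T 0) t.
Hypothesis exT : forall n, pexact (cdiff T n.+1) (cdiff T n).
Variables (P : complex A) (e : hom (P 0) H) (resP : is_projective_resolution e).
Variables (a : chain_map P T) (aP : t ∘ a 0 = e).
Variable W : A.
Hypothesis TW : forall n k, Ext_zero epA (T n) W k.+1.

Let K := cone a.

Lemma acyclic_cone_exact0 : epi (cdiff K 0).
Proof.
have [_ eP xP0 _] := resP; apply: (epi_projective_test epA) => Q h projQ.
have tP : t ∘ a 0 = idm H ∘ e by rewrite mcomp1m.
(* The cokernel of the identity is encoded as the zero map on [H], so that every map into [K 0]
   lifts. *)
have idx : pexact (idm H) (0 : hom H H).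
  by split=> [|R g _ _]; [rewrite mcomp0m|exists g; rewrite mcomp1m].
have [_ lift] := cone_exact0 tP idx eP exT0.
by apply: lift => //; rewrite !mcomp0m.
Qed.

Lemma acyclic_cone_exact n : pexact (cdiff K n.+1) (cdiff K n).
Proof.
have [_ _ xP0 xP] := resP.
have tP : t ∘ a 0 = idm H ∘ e by rewrite mcomp1m.
apply: (cone_exact tP (iso_mono (iso_id H)) (exact_pexact xP0) _ exT0 exT) => m.
exact/exact_pexact/xP.
Qed.

Lemma cone_boundary_epi n : epi (boundary K n).
Proof.
case: n => [|n].
  have := acyclic_cone_exact0; rewrite -boundaryP => epib X g h gh.
  have [s sP] : exists s, cycles_in K 0 ∘ s = idm (K 0).
    by apply: ker_lift_ex; rewrite mcomp0m.
  have sK : s ∘ cycles_in K 0 = idm _.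
    by apply: cycles_in_mono; rewrite mcompA sP mcomp1m mcompm1.
  have : g ∘ s = h ∘ s.
    by apply: epib; rewrite !mcompA -2!(mcompA _ s) sK !mcompm1.
  by move/(congr1 (fun z => z ∘ cycles_in K 0)); rewrite -!mcompA sK !mcompm1.
apply: (epi_projective_test epA) => Q h projQ.
have [|u uP] := (acyclic_cone_exact n).2 Q (cycles_in K n.+1 ∘ h) projQ.
  by rewrite mcompA (ker_inP (cout K n.+1)).1 mcomp0m.
exists u; apply: (@cycles_in_mono _ K n.+1).
by rewrite mcompA boundaryP.
Qed.

Lemma cone_cycles_exact n : pexact (cycles_in K n.+1) (boundary K n).
Proof.
have mK := @cycles_in_mono _ K n.
split=> [|Q h _ bh].
  by apply: (mono_eq0 mK); rewrite mcompA boundaryP (ker_inP (cout K n.+1)).1.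
have dh : cdiff K n ∘ h = 0 by rewrite -boundaryP -mcompA bh mcompm0.
exact: ker_lift_ex dh.
Qed.

(** [K n.+1] is an extension of [T n.+1] by the projective object [P n]. *)
Lemma cone_Ext_zero n k : Ext_zero epA (K n) W k.+1.
Proof.
have [pP _ _ _] := resP; case: n => [|n]; first exact: TW.
have [h1 h2 h3 h4 h5] := biprodP (bsum (P n) (T n.+1)).
apply: (Ext_zero_mid (i := cone_inl P T n) (p := prr_b (bsum (P n) (T n.+1)))).
- by move=> V x y /(congr1 (mcomp (prl_b _))); rewrite !mcompA h1 !mcomp1m.
- move=> V x y /(congr1 (fun z => z ∘ inr_b (bsum (P n) (T n.+1)))).
  by rewrite -!mcompA h2 !mcompm1.
- split=> [|Q h _ qh]; first exact: h4.
  exists (prl_b _ ∘ h); rewrite [RHS](biprod_elt h).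
  by rewrite qh mcompm0 addr0.
- exact: Ext_zero_projective.
exact: TW.
Qed.

(** Induction along [0 -> Z_(n+1) -> K_(n+1) -> Z_n -> 0], starting from [Z_0 = K_0], for all Ext
    degrees at once. *)
Lemma cone_cycles_Ext_zero n k : Ext_zero epA (cycles K n) W k.+1.
Proof.
elim: n k => [|n IHn] k.
  have [s sP] : exists s, cycles_in K 0 ∘ s = idm (K 0).
    by apply: ker_lift_ex; rewrite mcomp0m.
  apply: (Ext_zero_iso (f := s)); last exact: cone_Ext_zero.
  exists (cycles_in K 0); split=> //.
  by apply: cycles_in_mono; rewrite mcompA sP mcomp1m mcompm1.
apply: (Ext_zero_sub (i := cycles_in K n.+1) (p := boundary K n)).
- exact: cycles_in_mono.
- exact: cone_boundary_epi.
- exact: cone_cycles_exact.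
- exact: IHn.
exact: cone_Ext_zero.
Qed.

Lemma cone_cycles_extend n (u : hom (cycles K n) W) :
  exists v, v ∘ cycles_in K n = u.
Proof.
case: n u => [|n] u.
  have [s sP] : exists s, cycles_in K 0 ∘ s = idm (K 0).
    by apply: ker_lift_ex; rewrite mcomp0m.
  exists (u ∘ s); rewrite -mcompA -[RHS]mcompm1; congr (_ ∘ _).
  by apply: cycles_in_mono; rewrite mcompA sP mcomp1m mcompm1.
apply: (Ext_zero_extend (i := cycles_in K n.+1) (p := boundary K n)).
- exact: cycles_in_mono.
- exact: cone_boundary_epi.
- exact: cone_cycles_exact.
exact: cone_cycles_Ext_zero.
Qed.

(** A cocycle on [K n.+1] factors through [cycles K n], and the factor extends to [K n] because
    [Ext^1] of the next lower cycles vanishes. *)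
Lemma acyclic_cone_cohom_zero n : cohom_zero K W n.
Proof.
case: n => [|n] u ud.
  by exists 0; rewrite mcomp0m; exact: epi_eq0 acyclic_cone_exact0 ud.
have exK : pexact (cdiff K n.+1) (boundary K n).
  split=> [|Q h projQ bh].
    by apply: cycles_in_mono; rewrite mcompm0 mcompA boundaryP cdiff_cdiff.
  by apply: (acyclic_cone_exact n).2 => //; rewrite -boundaryP -mcompA bh mcompm0.
have [u' u'P] :=
  epi_exact_factor (@cone_boundary_epi n) (pexact_exact epA exK) ud.
have [v vP] := cone_cycles_extend u'.
by exists v; rewrite -u'P -vP -mcompA boundaryP.
Qed.

Lemma cone_dl_decomp n (h : hom (K n) W) :
  exists v : hom (cprev P n) W,
    h ∘ cone_dl a n = h ∘ cone_inr P T n ∘ a n + v ∘ cout P n.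
Proof.
case: n h => [|n] h; first by exists 0; rewrite /= mcompm1 mcomp0m addr0.
by exists (- (h ∘ cone_inl P T n)); rewrite /= mcompBr mcompNl !mcompA.
Qed.

(** Extended by zero on [T n.+1], [u] is a cocycle of the cone; [g] is the [T]-component of a
    cochain bounding it. *)
Lemma acyclic_comparison_surj n (u : hom (P n) W) :
  u ∘ cdiff P n = 0 ->
  exists (g : hom (T n) W) (v : hom (cprev P n) W),
    g ∘ cdiff T n = 0 /\ u = g ∘ a n + v ∘ cout P n.
Proof.
move=> ud; have [u' [u'l u'r]] := cone_desc a (n := n) u 0.
have [|h hP] := acyclic_cone_cohom_zero (n := n.+1) (u := u').
  apply: cone_hom_eq; rewrite mcomp0m -mcompA.
    by rewrite cone_diff_inl mcompBr !mcompA u'l u'r mcomp0m sub0r ud oppr0.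
  by rewrite cone_diff_inr mcompA u'r mcomp0m.
have gd : (h ∘ cone_inr P T n) ∘ cdiff T n = 0.
  by rewrite -mcompA -(cone_diff_inr a) mcompA -hP u'r.
have [v vP] := cone_dl_decomp h; exists (h ∘ cone_inr P T n), v; split=> //.
by rewrite -vP -u'l hP -mcompA cone_diff_inl.
Qed.

Lemma acyclic_comparison_inj n (g : hom (T n) W) (v : hom (cprev P n) W) :
  g ∘ cdiff T n = 0 -> g ∘ a n = v ∘ cout P n ->
  exists w : hom (cprev T n) W, g = w ∘ cout T n.
Proof.
case: n g v => [|n] g v gd ga.
  apply: (acyclic_cone_cohom_zero (n := 0)).
  apply: cone_hom_eq; rewrite mcomp0m -mcompA.
    by rewrite cone_diff_inl ga mcompm0.
  by rewrite cone_diff_inr /= mcomp1m.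
have [u [ul ur]] := cone_desc a v g.
have [|w wP] := acyclic_cone_cohom_zero (n := n.+1) (u := u).
  apply: cone_hom_eq; rewrite mcomp0m -mcompA.
    by rewrite cone_diff_inl mcompBr !mcompA ul ur ga subrr.
  by rewrite cone_diff_inr mcompA ur.
exists (w ∘ cone_inr P T n).
by rewrite -ur wP -mcompA cone_diff_inr mcompA.
Qed.

End AcyclicResolution.

(** * Left derived functors of a left adjoint *)

Section Transposition.
Variables (A B : abelian_category) (F : functor A B) (G : functor B A).
Variable adj : adjunction F G.

Definition transp (X : A) (Y : B) (u : hom (F X) Y) : hom X (G Y) :=
  fmap G u ∘ unit adj X.

Lemma transp_comp (X X' : A) (Y : B) (u : hom (F X) Y) (f : hom X' X) :
  transp (u ∘ fmap F f) = transp u ∘ f.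
Proof. by rewrite /transp fmapM -!mcompA -unit_nat. Qed.

Lemma transp_inj (X : A) (Y : B) (u v : hom (F X) Y) :
  transp u = transp v -> u = v.
Proof.
have E (w : hom (F X) Y) : w = counit adj Y ∘ fmap F (transp w).
  by rewrite /transp fmapM mcompA -counit_nat -mcompA unit_counit mcompm1.
by move=> uv; rewrite (E u) uv -E.
Qed.

Lemma transp_surj (X : A) (Y : B) (v : hom X (G Y)) : exists u, transp u = v.
Proof.
exists (counit adj Y ∘ fmap F v).
by rewrite /transp fmapM -mcompA -unit_nat mcompA counit_unit mcomp1m.
Qed.

Lemma transpD (X : A) (Y : B) (u v : hom (F X) Y) :
  transp (u + v) = transp u + transp v.
Proof. by rewrite /transp (right_adjoint_additive adj) mcompDl. Qed.

Lemma transp0 (X : A) (Y : B) : transp (0 : hom (F X) Y) = 0.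
Proof. by rewrite /transp fmap0 ?mcomp0m //; exact: right_adjoint_additive adj. Qed.

Lemma transp_eq0 (X : A) (Y : B) (u : hom (F X) Y) : transp u = 0 -> u = 0.
Proof. by rewrite -(transp0 X Y) => /transp_inj. Qed.

Variable addF : additive_functor F.

(** In degree 0 the two [cprev] are the zero objects of different categories, not related by [F];
    hence the existential form. *)
Lemma transp_coboundary (C : complex A) (J : B) n
    (v : hom (cprev (map_complex addF C) n) J) :
  exists v' : hom (cprev C n) (G J),
    transp (v ∘ cout (map_complex addF C) n) = v' ∘ cout C n.
Proof.
case: n v => [|n] v; last by exists (transp v); exact: transp_comp.
by exists 0; rewrite !mcompm0; exact: transp0.
Qed.

Lemma coboundary_transp (C : complex A) (J : B) n
    (v' : hom (cprev C n) (G J)) :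
  exists v : hom (cprev (map_complex addF C) n) J,
    transp (v ∘ cout (map_complex addF C) n) = v' ∘ cout C n.
Proof.
case: n v' => [|n] v'.
  by exists 0; rewrite !mcompm0; exact: transp0.
by have [v <-] := transp_surj v'; exists v; exact: transp_comp.
Qed.

Lemma transp_cocycle (C : complex A) (J : B) n
    (u : hom (map_complex addF C n) J) :
  u ∘ cdiff (map_complex addF C) n = 0 -> transp u ∘ cdiff C n = 0.
Proof. by rewrite -transp_comp => ->; exact: transp0. Qed.

Lemma cocycle_transp (C : complex A) (J : B) n
    (u : hom (map_complex addF C n) J) :
  transp u ∘ cdiff C n = 0 -> u ∘ cdiff (map_complex addF C) n = 0.
Proof. by rewrite -transp_comp => /transp_eq0. Qed.

(** Right exactness of a left adjoint: the transpose of [h] kills [f], hence factors through [g]. *)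
Lemma left_adjoint_exact_factor (X Y Z : A) (J : B) (f : hom X Y) (g : hom Y Z)
    (h : hom (F Y) J) :
  epi g -> exact f g -> h ∘ fmap F f = 0 -> exists u, u ∘ fmap F g = h.
Proof.
move=> eg fg /(congr1 (@transp _ _)); rewrite transp_comp transp0.
move=> /(epi_exact_factor eg fg)[v vg]; have [u uv] := transp_surj v.
by exists u; apply: transp_inj; rewrite transp_comp uv.
Qed.

End Transposition.

Section LeftDerivedVanishing.
Variables (A B : abelian_category).
Variables (epA : enough_projectives A) (eiB : enough_injectives B).
Variables (F : functor A B) (G : functor B A) (adj : adjunction F G).

Lemma LF_zeroP (X : A) (n : nat) :
  is_zero (LF epA adj n X) <->
  forall J : B, injective_obj J -> Ext_zero epA X (G J) n.
Proof.
split=> [/(homology_zeroP eiB) H0 J injJ u ud|E0].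
  have [u' uE] := transp_surj adj u; rewrite -uE in ud *.
  have [v vP] := H0 J u' injJ (cocycle_transp ud).
  by have [v' v'P] := transp_coboundary adj v; exists v'; rewrite -v'P -vP.
apply/(homology_zeroP eiB) => J u injJ ud.
have [v vP] := E0 J injJ _ (transp_cocycle adj ud).
have [w wP] := coboundary_transp adj (left_adjoint_additive adj) v.
by exists w; apply: (transp_inj (adj := adj)); rewrite wP.
Qed.

(** Vanishing of the single functor [L_d F] propagates to higher degrees through syzygies, on the
    level of [Ext(-, G J)]. *)
Lemma LF_zero_bound :
  finite_homological_dimension epA adj ->
  exists d : nat, forall n X, (d <= n)%N -> is_zero (LF epA adj n X).
Proof.
move=> [[d|d] [] // _ Ld]; exists d => n X /subnKC<-; apply/LF_zeroP => J injJ.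
elim: (n - d)%N X => [|k IHk] X; last by rewrite addnS; exact: Ext_zeroS.
by rewrite addn0; apply/LF_zeroP: J injJ.
Qed.

Section ShortExactSequence.
Variables (X Y Z : A) (i : hom X Y) (p : hom Y Z).
Hypotheses (mi : mono i) (epip : epi p) (ip : pexact i p).

Lemma LF_zero_sub (n : nat) :
  is_zero (LF epA adj n.+2 Z) -> is_zero (LF epA adj n.+1 Y) ->
  is_zero (LF epA adj n.+1 X).
Proof.
move=> /LF_zeroP Z0 /LF_zeroP Y0; apply/LF_zeroP => J injJ.
exact: (Ext_zero_sub mi epip ip (Z0 _ _) (Y0 _ _)).
Qed.

(** A map from [F X] to an injective [J] extends along [fmap F i] because its transpose extends
    along [i], as [Ext^1(Z, G J) = 0]. *)
Lemma LF_zero_mono : is_zero (LF epA adj 1 Z) -> mono (fmap F i).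
Proof.
move=> /LF_zeroP Z0; apply: (mono_injective_test eiB) => J u injJ.
have [v vi] := Ext_zero_extend mi epip ip (transp adj u) (Z0 J injJ).
have [w wv] := transp_surj adj v.
by exists w; apply: (transp_inj (adj := adj)); rewrite transp_comp wv.
Qed.

End ShortExactSequence.

Lemma acyclic_comparison_iso (H : A) (T P : complex A) (t : hom (T 0) H)
    (e : hom (P 0) H) (a : chain_map P T) (addF : additive_functor F) n :
  pexact (cdiff T 0) t ->
  (forall n, pexact (cdiff T n.+1) (cdiff T n)) ->
  is_projective_resolution e -> t ∘ a 0 = e ->
  (forall n, F_acyclic epA adj (T n)) ->
  is_iso (homology_map (map_chain_map addF a) n).
Proof.
move=> exT0 exT resP ta acT.
have TW (J : B) : injective_obj J ->
    forall m k, Ext_zero epA (T m) (G J) k.+1.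
  by move=> injJ m k; apply/LF_zeroP: J injJ; exact: acT.
apply: (homology_map_iso_test eiB) => [J u injJ ud|J g v injJ gd gv].
  have [g [v [gd uE]]] := acyclic_comparison_surj exT0 exT resP ta
    (TW J injJ) (transp_cocycle adj ud).
  have [g' g'E] := transp_surj adj g; rewrite -g'E in gd uE.
  have [v' v'E] := coboundary_transp adj addF v.
  exists g', v'; split; first exact: cocycle_transp gd.
  by apply: (transp_inj (adj := adj)); rewrite transpD v'E transp_comp.
have [v' v'E] := transp_coboundary adj v.
have [||w wE] := acyclic_comparison_inj exT0 exT resP ta (TW J injJ)
  (g := transp adj g) (v := v').
- exact: transp_cocycle gd.
- by rewrite -v'E -gv -transp_comp.
have [w' w'E] := coboundary_transp adj addF w.
by exists w'; apply: (transp_inj (adj := adj)); rewrite w'E.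
Qed.

End LeftDerivedVanishing.

(** * The truncated image of an injective resolution *)

Section IntIndexed.
Variable B : abelian_category.

(* A cochain complex of B, extended by zero to negative degrees. *)
Definition zobj (C : complex (op_category B)) (m : int) : B :=
  match m with Posz n => C n | Negz _ => zero_obj B end.

(* The differential from degree i to degree j; it is zero unless j = i + 1. *)
Definition zdiff (C : complex (op_category B)) (i j : int) :
    @hom B (zobj C i) (zobj C j) :=
  match i, j return @hom B (zobj C i) (zobj C j) with
  | Posz n, Posz m =>
    match @eqP _ n.+1 m with
    | ReflectT e => ecast k (@hom B (C n) (C k)) e (cdiff C n)
    | ReflectF _ => 0
    end
  | _, _ => 0
  end.

Definition zmap (C D : complex (op_category B)) (f : chain_map C D) (m : int) :
    @hom B (zobj D m) (zobj C m) :=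
  match m with Posz n => f n | Negz _ => 0 end.

Definition zaug (C : complex (op_category B)) (Y : B)
    (e : @hom (op_category B) (C 0) Y) (m : int) : @hom B Y (zobj C m) :=
  match m with Posz 0 => e | _ => 0 end.

Lemma zdiffS (C : complex (op_category B)) n :
  zdiff C (Posz n) (Posz n.+1) = cdiff C n.
Proof. by rewrite /zdiff; case: eqP => // e; rewrite eq_axiomK. Qed.

Lemma zdiff_neg (C : complex (op_category B)) i j : i < 0 -> zdiff C i j = 0.
Proof. by case: i. Qed.

Lemma zdiff_zdiff (C : complex (op_category B)) i j k :
  j = i + 1 -> k = j + 1 -> zdiff C j k ∘ zdiff C i j = 0.
Proof.
case: i => [n|n] ij jk; last by rewrite mcompm0.
have -> : j = Posz n.+1 by lia.
have -> : k = Posz n.+2 by lia.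
by rewrite !zdiffS; exact: (cdiff_cdiff C n).
Qed.

Lemma zmap_zdiff (C D : complex (op_category B)) (f : chain_map C D) i j :
  j = i + 1 -> zdiff C i j ∘ zmap f i = zmap f j ∘ zdiff D i j.
Proof.
case: i => [n|n] ij; last by rewrite mcompm0 mcompm0.
have -> : j = Posz n.+1 by lia.
by rewrite !zdiffS; exact: esym (cmap_comm f n).
Qed.

Section Resolution.
Variables (C : complex (op_category B)) (Y : B).
Variable e : @hom (op_category B) (C 0) Y.
Hypothesis resC : is_projective_resolution e.

Lemma zobj_injective m : injective_obj (zobj C m).
Proof.
case: m => [n|n]; first exact: pres_proj resC n.
exact: zero_injective (zero_objP B).
Qed.

Lemma zdiff_exact i j k (J : B) (u : hom (zobj C j) J) :
  j = i + 1 -> k = j + 1 -> j <> 0 -> injective_obj J ->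
  u ∘ zdiff C i j = 0 -> exists w, u = w ∘ zdiff C j k.
Proof.
move=> ij jk j0 injJ.
case: i ij => [n|n] ij; last first.
  have [m Em] : exists m, j = Negz m by case: n ij => [|n] ij; [|exists n]; lia.
  rewrite {j ij jk j0}Em in u *; exists 0.
  by rewrite mcomp0m; exact: (zero_objP B).1.
have Ej : j = Posz n.+1 by lia.
have Ek : k = Posz n.+2 by lia.
rewrite {ij jk j0 j}Ej {k}Ek in u *; rewrite !zdiffS => ud.
by have [w wP] := (exact_pexact (pres_exact resC n)).2 J u injJ ud; exists w.
Qed.

Lemma zaug_mono : mono (zaug e 0).
Proof. exact: pres_epi resC. Qed.

(** Exactness in the opposite category writes the first differential as a cokernel of the
    augmentation followed by a mono; a mono is the kernel of its cokernel. *)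
Lemma zaug_kernel k : k = 1 -> is_kernel (zdiff C 0 k) (zaug e 0).
Proof.
move=> ->; have [K [c [q [ec qK dE]]]] := pres_exact0 resC.
rewrite (zdiffS C 0) dE.
have [qe qU] := epi_kernel_cokernel (A := op_abelian_category B)
  (pres_epi resC) qK.
split=> [|W h]; first by rewrite -[LHS](@mcompA B) [X in _ ∘ X]qe mcompm0.
rewrite -[_ ∘ h](@mcompA B) => ch; apply: qU; exact: (mono_eq0 (A := B) ec ch).
Qed.

End Resolution.

End IntIndexed.

(* Both sides are convertible; the explicit cast keeps the unifier from comparing
   the objects X and Y with each other. *)
Definition of_op (A : category) (X Y : A) (f : @hom (op_category A) Y X) :
  @hom A X Y := f.

Lemma of_op_square (A : category) (X Y X' Y' : A)
    (a : @hom (op_category A) Y X) (b : @hom (op_category A) Y' Y)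
    (c : @hom (op_category A) X' X) (d : @hom (op_category A) Y' X') :
  a ∘ b = c ∘ d -> of_op b ∘ of_op a = of_op d ∘ of_op c.
Proof. by []. Qed.

(** [s] embeds the homology, defined as cycles modulo boundaries, into the cokernel [M] of the
    incoming differential. The last two clauses are injectivity of [s] and exactness at [M], tested
    on injectives. *)
Lemma homology_in_coker (E : abelian_category) (D : complex E) n (M : E)
    (q : hom (D n) M) :
  is_cokernel (cdiff D n) q ->
  exists s : hom (homology D n) M,
    [/\ s ∘ homology_proj D n = q ∘ cycles_in D n,
      forall (J : E) (v : hom (homology D n) J), injective_obj J ->
        exists w, w ∘ s = v &
      forall (J : E) (u : hom M J), injective_obj J -> u ∘ s = 0 ->
        exists w, u ∘ q = w ∘ cout D n].
Proof.
move=> qC; have [s sP] : exists s, s ∘ homology_proj D n = q ∘ cycles_in D n.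
  by apply: coker_desc_ex; rewrite -mcompA boundaryP qC.1.
exists s; split=> // J u injJ.
  have [v vP] := injJ _ _ _ (u ∘ homology_proj D n) (@cycles_in_mono _ D n).
  have [|w [wq _]] := qC.2 _ v.
    by rewrite -boundaryP mcompA vP -mcompA (coker_outP _).1 mcompm0.
  exists w; apply: (@homology_proj_epi _ D n).
  by rewrite -mcompA sP mcompA wq vP.
move=> us; apply: injective_ker_factor injJ (ker_inP (cout D n)) _.
by rewrite -mcompA -sP mcompA us mcomp0m.
Qed.

Import Order.TTheory Num.Theory.

(** * The isomorphism [L_l F(R^l G(Y)) -> Y] for [l >= 0] *)

Section Core.
Variables (A B : abelian_category).
Variables (epA : enough_projectives A) (eiB : enough_injectives B).
Variables (F : functor A B) (G : functor B A) (adj : adjunction F G).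
Variable l : nat.

Let addG := right_adjoint_additive adj.

Let injres (Y : B) : complex (op_category B) :=
  @pres (op_abelian_category B) (op_enough_projectives eiB) Y.

Let injaug (Y : B) : @hom (op_category B) (injres Y 0) Y :=
  @pres_aug (op_abelian_category B) (op_enough_projectives eiB) Y.

Let injresP (Y : B) : is_projective_resolution (injaug Y).
Proof. exact: (@presP (op_abelian_category B)). Qed.

Section Object.
Variable Y : B.
Let I := zobj (injres Y).
Let d i j : hom (I i) (I j) := zdiff (injres Y) i j.

Definition cocycles (m : int) : A := ker (fmap G (d m (m + 1))).
Definition cocycles_in (m : int) : hom (cocycles m) (G (I m)) :=
  ker_in (fmap G (d m (m + 1))).

Lemma cocycles_inP m k :
  k = m + 1 -> is_kernel (fmap G (d m k)) (cocycles_in m).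
Proof. by move=> ->; exact: ker_inP. Qed.

Lemma cocycles_in_mono m : mono (cocycles_in m).
Proof. exact: kernel_mono (ker_inP _). Qed.

(** The cohomological degree [l - n] of the n-th term of the truncation. The recursion makes [idx 0]
    convertible to [l], as the type of [trunc_in] requires. *)
Fixpoint idx (n : nat) : int := if n is m.+1 then idx m - 1 else l%:Z.

Lemma idxS n : idx n = idx n.+1 + 1.
Proof. by rewrite /= subrK. Qed.

Lemma idxE n : idx n = l%:Z - n%:Z.
Proof. by elim: n => [|n IHn] /=; rewrite ?IHn; lia. Qed.

(* The truncation of G I at the l-cocycles, read as a chain complex. *)
Definition trunc_obj (n : nat) : A :=
  if n is m.+1 then G (I (idx m.+1)) else cocycles l.

Definition trunc_in (n : nat) : hom (trunc_obj n) (G (I (idx n))) :=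
  match n with 0 => cocycles_in l | m.+1 => idm (G (I (idx m.+1))) end.

Lemma trunc_in_mono n : mono (trunc_in n).
Proof.
by case: n => [|n]; [exact: cocycles_in_mono|exact: iso_mono (iso_id _)].
Qed.

Lemma trunc_diff_ex n :
  exists x : hom (trunc_obj n.+1) (trunc_obj n),
    trunc_in n ∘ x = fmap G (d (idx n.+1) (idx n)).
Proof.
case: n => [|n]; last by eexists; exact: mcomp1m.
apply: ker_lift_ex; rewrite -fmapM zdiff_zdiff ?fmap0 //; exact: idxS 0%N.
Qed.

Definition trunc_diff n : hom (trunc_obj n.+1) (trunc_obj n) :=
  sval (cid (trunc_diff_ex n)).

Lemma trunc_in_diff n :
  trunc_in n ∘ trunc_diff n =
  fmap G (d (idx n.+1) (idx n)) ∘ trunc_in n.+1.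
Proof. by rewrite mcompm1; exact: svalP (cid (trunc_diff_ex n)). Qed.

Lemma trunc_diff_diff n : trunc_diff n ∘ trunc_diff n.+1 = 0.
Proof.
apply: trunc_in_mono; rewrite mcompm0 mcompA trunc_in_diff -mcompA.
rewrite trunc_in_diff mcompA -fmapM zdiff_zdiff ?fmap0 ?mcomp0m //; exact: idxS.
Qed.

Definition trunc : complex A := Complex trunc_diff_diff.

Lemma zero_obj_fmap (W : A) (h : hom W (G (zero_obj B))) : h = 0.
Proof.
have := fmap1 G (zero_obj B).
rewrite (zero_id (zero_objP B)) fmap0 // => G0.
by rewrite -[h]mcomp1m -G0 mcomp0m.
Qed.

Definition Gcomplex : complex (op_category A) :=
  map_complex (F := op_functor G) (fun X Y f g => addG f g) (injres Y).

(** Projectives of [A] are the injectives of its opposite, so [homology_zeroP] applied there gives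
    exactness tested on projectives. *)
Lemma pexact_fmap_zdiff i j k :
  is_zero (RG eiB adj j Y) -> j = i + 1 -> k = j + 1 ->
  pexact (fmap G (d i j)) (fmap G (d j k)).
Proof.
move=> H0 ij jk; split=> [|Q h projQ].
  by rewrite -fmapM zdiff_zdiff ?fmap0.
case: j H0 ij jk h => [n|n] H0 ij jk h; last first.
  by exists 0; rewrite mcompm0; exact: esym (zero_obj_fmap h).
have -> : k = Posz n.+1 by lia.
rewrite /d zdiffS => dh.
have H0' : @is_zero (op_abelian_category A)
    (@homology (op_abelian_category A) Gcomplex n).
  by have [H1 H2] := H0; split.
have [v vP] := (@homology_zeroP (op_abelian_category A) epA Gcomplex n).1 H0' Q h
  projQ dh.
clear H0 H0' dh; case: n ij jk h v vP => [|n] ij jk h v vP.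
  by exists 0; rewrite vP mcompm0; exact: esym (@mcomp0m A _ _ _ v).
have -> : i = Posz n by lia.
by exists v; rewrite /d zdiffS vP.
Qed.

Hypothesis GI_acyclic : forall J : B, injective_obj J -> F_acyclic epA adj (G J).
Hypothesis counit_iso : forall J : B, injective_obj J -> is_iso (counit adj J).
Hypothesis fin_dim : finite_homological_dimension epA adj.

Lemma GI_LF_zero m n : is_zero (LF epA adj n.+1 (G (I m))).
Proof. by apply: GI_acyclic => //; exact: (zobj_injective (injresP Y) (m := m)). Qed.

Section Vanishing.
Variable b : int.
Hypothesis RG_zero : forall j, b < j -> is_zero (RG eiB adj j Y).

(** Exactness of [G I] in degree [m + 1 > b] makes the differential map onto the next cocycles. The
    bound [b] is separate from [l] because [negative_concentrated_zero] takes it negative. *)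
Lemma cocycles_ses m : b <= m ->
  exists p : hom (G (I m)) (cocycles (m + 1)),
    [/\ cocycles_in (m + 1) ∘ p = fmap G (d m (m + 1)), epi p &
        pexact (cocycles_in m) p].
Proof.
move=> bm; have [p pP] : exists p, cocycles_in (m + 1) ∘ p = fmap G (d m (m + 1)).
  by apply: ker_lift_ex; rewrite -fmapM zdiff_zdiff ?fmap0.
have mono1 := @cocycles_in_mono (m + 1).
exists p; split=> //.
  apply: (epi_projective_test epA) => Q h projQ.
  have [_ lift] : pexact (fmap G (d m (m + 1))) (fmap G (d (m + 1) (m + 1 + 1))).
    by apply: pexact_fmap_zdiff => //; apply: RG_zero; lia.
  have [|u uP] := lift Q (cocycles_in (m + 1) ∘ h) projQ.
    by rewrite mcompA (cocycles_inP _).1 ?mcomp0m.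
  by exists u; apply: mono1; rewrite mcompA pP.
split=> [|Q h _ ph].
  by apply: (mono_eq0 mono1); rewrite mcompA pP (cocycles_inP _).1.
by apply: ker_lift_ex; rewrite -pP -mcompA ph mcompm0.
Qed.

Lemma cocycles_acyclic m n : b <= m -> is_zero (LF epA adj n.+1 (cocycles m)).
Proof.
have [D L0] := LF_zero_bound eiB fin_dim.
(* [k] counts the remaining shifts from [L_(n+1) F(Z^m)] to [L_(n+2) F(Z^(m+1))] before the degree
   passes [D]. *)
suff van k : forall n m, b <= m -> (D <= n + k)%N ->
    is_zero (LF epA adj n.+1 (cocycles m)).
  by move=> bm; apply: (van D) => //; lia.
elim: k => [|k IHk] {}n {}m bm Dn; first by apply: L0; lia.
have [p [pP ep ip]] := cocycles_ses bm.
apply: (LF_zero_sub eiB (cocycles_in_mono (m := m)) ep ip); last exact: GI_LF_zero.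
by apply: IHk; lia.
Qed.

Lemma fmap_cocycles_in_mono m : b <= m -> mono (fmap F (cocycles_in m)).
Proof.
move=> bm; have [p [pP ep ip]] := cocycles_ses bm.
apply: (LF_zero_mono eiB (cocycles_in_mono (m := m)) ep ip).
by apply: cocycles_acyclic; lia.
Qed.

(* Since F preserves the exactness of G I beyond degree b, the counit identifies
   F of the cocycles with the cocycles of I. *)
Lemma counit_cocycles_exact m k (J : B) (v : hom (I m) J) :
  b <= m -> k = m + 1 -> injective_obj J ->
  v ∘ counit adj (I m) ∘ fmap F (cocycles_in m) = 0 ->
  exists w, v = w ∘ d m k.
Proof.
move=> bm -> injJ v0; have [p [pP ep ip]] := cocycles_ses bm.
have [u uP] := left_adjoint_exact_factor adj ep (pexact_exact epA ip) v0.
have [w wP] : exists w, w ∘ fmap F (cocycles_in (m + 1)) = u.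
  by apply: injJ; apply: fmap_cocycles_in_mono; lia.
have [c' [c'c cc']] := counit_iso (zobj_injective (injresP Y) (m := m + 1)).
exists (w ∘ c').
apply: (iso_epi (counit_iso (zobj_injective (injresP Y) (m := m)))).
rewrite -uP -wP -[RHS]mcompA counit_nat.
by rewrite -!mcompA (mcompA c') c'c mcomp1m -pP fmapM.
Qed.

End Vanishing.

(** [G I] is exact in degree 0 and preceded by zero, so it has no 0-cocycles; hence maps from [I^0]
    to injectives factor through the differential and vanish on [Y]. *)
Lemma negative_concentrated_zero b :
  b < 0 -> (forall j, b < j -> is_zero (RG eiB adj j Y)) -> is_zero Y.
Proof.
move=> b0 RG0.
have i0 : cocycles_in 0 = 0.
  have [Q [q [projQ eq]]] := epA (cocycles 0).
  have [_ lift] : pexact (fmap G (d (-1) 0)) (fmap G (d 0 1)).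
    by apply: pexact_fmap_zdiff => //; exact: RG0.
  have [|u uP] := lift Q (cocycles_in 0 ∘ q) projQ.
    by rewrite mcompA (cocycles_inP _).1 ?mcomp0m.
  by apply: (epi_eq0 eq); rewrite -uP /d /= fmap0 ?mcomp0m.
apply: (zero_injective_test eiB) => J u injJ.
have [v <-] := injJ _ _ _ u (zaug_mono (injresP Y)).
have v0 : v ∘ counit adj (I 0) ∘ fmap F (cocycles_in 0) = 0.
  by rewrite i0 fmap0 ?mcompm0 //; exact: left_adjoint_additive adj.
have [w ->] := counit_cocycles_exact RG0 (k := 1) (ltW b0) erefl injJ v0.
by rewrite -mcompA (zaug_kernel (injresP Y) _).1 ?mcompm0.
Qed.

Definition coh_obj : A := @homology (op_abelian_category A) Gcomplex l.
(** Cycles in the opposite category: the cokernel of the differential of [G I] into degree [l], with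
    [coh_obj] as a subobject. *)
Definition coh_quot_obj : A := @cycles (op_abelian_category A) Gcomplex l.
Definition coh_in : hom coh_obj coh_quot_obj :=
  @of_op A coh_obj coh_quot_obj (@homology_proj (op_abelian_category A) Gcomplex l).
Definition coh_quot : hom (G (I l)) coh_quot_obj :=
  @of_op A (G (I l)) coh_quot_obj
    (@cycles_in (op_abelian_category A) Gcomplex l).

Lemma coh_in_mono : mono coh_in.
Proof. exact: (@homology_proj_epi (op_abelian_category A) Gcomplex l). Qed.

Lemma coh_quot_fmap i : l%:Z = i + 1 -> coh_quot ∘ fmap G (d i l) = 0.
Proof.
rewrite /coh_quot /coh_quot_obj; case: l => [|q] iq.
  have -> : i = Negz 0 by lia.
  by rewrite /d /= fmap0 // mcompm0.
have -> : i = Posz q by lia.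
rewrite /d zdiffS.
exact: (@ker_inP (op_abelian_category A) _ _
  (@cout (op_abelian_category A) Gcomplex q.+1)).1.
Qed.

Lemma Gcomplex_cout_factor (q : nat) i (Q : A)
    (w : hom Q (@cprev (op_abelian_category A) Gcomplex q)) : q%:Z = i + 1 ->
  exists u, fmap G (d i q) ∘ u =
    (@cout (op_abelian_category A) Gcomplex q : @hom A _ (G (I q))) ∘ w.
Proof.
case: q w => [|q] w iq.
  by exists 0; rewrite mcompm0; exact: esym (mcomp0m _ _).
have -> : i = Posz q by lia.
by exists w; rewrite /d zdiffS.
Qed.

(** [homology_in_coker] in the opposite category: [coh_obj] is the quotient of the cocycles by the
    coboundaries, tested on projectives. *)
Lemma coh_in_factor :
  exists s : hom (cocycles l) coh_obj,
    [/\ coh_in ∘ s = coh_quot ∘ cocycles_in l,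
      forall (Q : A) (v : hom Q coh_obj), projective_obj Q ->
        exists w, s ∘ w = v &
      forall (Q : A) (u : hom Q (cocycles l)), projective_obj Q -> s ∘ u = 0 ->
        exists w, cocycles_in l ∘ u =
          (@cout (op_abelian_category A) Gcomplex l : @hom A _ (G (I l))) ∘ w].
Proof.
have qC : @is_cokernel (op_category A) _ _ _ (cdiff Gcomplex l)
    (cocycles_in l : @hom (op_category A) (Gcomplex l) (cocycles l)).
  rewrite -/(@is_kernel A _ _ _ _ _); have := @cocycles_inP l l.+1.
  by rewrite /d zdiffS; apply; lia.
exact: (@homology_in_coker (op_abelian_category A) Gcomplex l _ _ qC).
Qed.

Lemma trunc_aug_ex :
  exists s : hom (cocycles l) coh_obj,
    [/\ coh_in ∘ s = coh_quot ∘ cocycles_in l, epi s & pexact (trunc_diff 0) s].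
Proof.
have [s [sP ext fac]] := coh_in_factor.
exists s; split=> //; first exact: (epi_projective_test epA ext).
have td := trunc_in_diff 0; rewrite mcompm1 /= in td.
split=> [|Q h projQ /(fac Q h projQ)[w wP]].
  apply: coh_in_mono; rewrite mcompm0 mcompA sP -mcompA td.
  by apply: coh_quot_fmap; rewrite subrK.
have [u uP] := Gcomplex_cout_factor (i := idx 1) w (esym (subrK _ _)).
exists u; apply: (cocycles_in_mono (m := l)).
by rewrite mcompA td uP wP.
Qed.

Definition trunc_aug : hom (trunc 0) coh_obj := sval (cid trunc_aug_ex).

Lemma trunc_augP :
  [/\ coh_in ∘ trunc_aug = coh_quot ∘ cocycles_in l, epi trunc_aug &
      pexact (cdiff trunc 0) trunc_aug].
Proof. exact: svalP (cid trunc_aug_ex). Qed.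

Let FT := map_complex (left_adjoint_additive adj) trunc.

(** Compares [F] of the truncation with [I]: an isomorphism in terms [n > 0], and in term 0 the map
    from [F] of the l-cocycles of [G I] to [I^l]. *)
Definition trunc_counit n : hom (FT n) (I (idx n)) :=
  counit adj (I (idx n)) ∘ fmap F (trunc_in n).

Lemma trunc_counit_diff n :
  trunc_counit n ∘ cdiff FT n = d (idx n.+1) (idx n) ∘ trunc_counit n.+1.
Proof.
rewrite /trunc_counit -mcompA -fmapM trunc_in_diff fmapM mcompA.
by rewrite -counit_nat mcompA.
Qed.

Lemma trunc_counit_iso n : is_iso (trunc_counit n.+1).
Proof.
rewrite /trunc_counit /= fmap1 mcompm1; apply: counit_iso.
exact: (zobj_injective (injresP Y)).
Qed.

Lemma trunc_counit_cout n k :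
  k = idx n + 1 -> exists x, d (idx n) k ∘ trunc_counit n = x ∘ cout FT n.
Proof.
case: n => [|n] nk; last first.
  have -> : k = idx n by rewrite nk subrK.
  by exists (trunc_counit n); rewrite trunc_counit_diff.
exists 0; rewrite mcompm0 mcompA counit_nat -mcompA -fmapM.
rewrite (cocycles_inP _).1 // fmap0 ?mcompm0 //; exact: left_adjoint_additive adj.
Qed.

Let zaugY m : hom Y (I m) := zaug (injaug Y) m.

Lemma idxl : idx l = 0.
Proof. by rewrite idxE subrr. Qed.

Lemma zaugY_kernel m k : m = 0 -> k = m + 1 -> is_kernel (d m k) (zaugY m).
Proof. by move=> -> ->; exact: (zaug_kernel (injresP Y) (add0r 1)). Qed.

(** The term [FT l] lies over [I^0], where cycles land in the kernel [Y] of the first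
    differential. *)
Lemma theta_ex :
  exists th : hom (homology FT l) Y,
    zaugY (idx l) ∘ (th ∘ homology_proj FT l) =
    trunc_counit l ∘ cycles_in FT l.
Proof.
have zK := zaugY_kernel idxl (erefl (idx l + 1)).
have [|z [zP _]] := zK.2 _ (trunc_counit l ∘ cycles_in FT l).
  have [x xP] := trunc_counit_cout (erefl (idx l + 1)).
  by rewrite mcompA xP -mcompA (ker_inP (cout FT l)).1 mcompm0.
have [|th thP] := coker_desc_ex (f := boundary FT l) (h := z); last first.
  by exists th; rewrite thP.
(* Boundaries die because they pass through degree [-1] of [I]. *)
apply: (mono_eq0 (kernel_mono zK)); rewrite mcompA zP -mcompA boundaryP.
by rewrite trunc_counit_diff /d zdiff_neg ?mcomp0m // idxE; lia.
Qed.

Definition theta : hom (homology FT l) Y := sval (cid theta_ex).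

Lemma thetaP :
  zaugY (idx l) ∘ (theta ∘ homology_proj FT l) =
  trunc_counit l ∘ cycles_in FT l.
Proof. exact: svalP (cid theta_ex). Qed.

Hypothesis Yconc : G_concentrated eiB adj l Y.

Let RG_zero j : l%:Z < j -> is_zero (RG eiB adj j Y).
Proof. by move=> lj; apply: Yconc => jl; rewrite jl ltxx in lj. Qed.

(** Exactness is needed in degrees [l - (n + 1)] only: here the vanishing of [R^i G(Y)] below [l]
    enters. *)
Lemma trunc_exact n : pexact (cdiff trunc n.+1) (cdiff trunc n).
Proof.
split=> [|Q h projQ dh]; first exact: trunc_diff_diff.
have [_ lift] := pexact_fmap_zdiff
  (Yconc (i := idx n.+1) ltac:(rewrite idxE; lia)) (idxS n.+1) (idxS n).
have [|u uP] := lift Q h projQ.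
  have := trunc_in_diff n; rewrite mcompm1 => <-.
  by rewrite -mcompA dh mcompm0.
exists u; rewrite -uP -[LHS]mcomp1m mcompA.
by have := trunc_in_diff n.+1; rewrite mcompm1 => ->.
Qed.

Lemma trunc_acyclic n : F_acyclic epA adj (trunc n).
Proof.
move=> [[|i]|i] // _; case: n => [|n]; last exact: GI_LF_zero.
exact: (cocycles_acyclic RG_zero).
Qed.

Lemma trunc_counit_mono n : mono (trunc_counit n).
Proof.
case: n => [|n]; last exact: iso_mono (trunc_counit_iso n).
apply: mono_comp; first exact: (fmap_cocycles_in_mono RG_zero).
apply: iso_mono; apply: counit_iso; exact: (zobj_injective (injresP Y)).
Qed.

Lemma trunc_counit_exact n k (J : B) (v : hom (I (idx n)) J) :
  k = idx n + 1 -> injective_obj J ->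
  v ∘ trunc_counit n ∘ cycles_in FT n = 0 -> exists w, v = w ∘ d (idx n) k.
Proof.
case: n v => [|n] v nk injJ v0.
  have [s sP] : exists s, cycles_in FT 0 ∘ s = idm (FT 0).
    by apply: ker_lift_ex; rewrite mcomp0m.
  apply: (counit_cocycles_exact RG_zero) => //.
  have := congr1 (fun z => z ∘ s) v0.
  by rewrite -[_ ∘ s]mcompA sP mcompm1 mcomp0m mcompA.
have -> : k = idx n by rewrite nk subrK.
have [w wP] := injective_ker_factor injJ (ker_inP (cout FT n.+1)) v0.
have [w' w'P] := injJ _ _ _ w (@trunc_counit_mono n).
exists w'; apply: (iso_epi (trunc_counit_iso n)).
by rewrite wP -w'P -mcompA /= trunc_counit_diff mcompA.
Qed.

(** A cocycle of [Hom(FT, J)] extends along the mono [trunc_counit n] to [I], which is exact in the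
    degree [l - n], different from 0. *)
Lemma trunc_homology_zero n : n != l -> is_zero (homology FT n).
Proof.
move=> nl; apply/(homology_zeroP eiB) => J u injJ ud.
have [v vP] := injJ _ _ _ u (@trunc_counit_mono n).
have n0 : idx n <> 0 by rewrite idxE; lia.
have vd : v ∘ d (idx n.+1) (idx n) = 0.
  apply: (epi_eq0 (iso_epi (trunc_counit_iso n))).
  by rewrite -mcompA -trunc_counit_diff mcompA vP ud.
have [w wP] := zdiff_exact (injresP Y) (idxS n) (erefl (idx n + 1)) n0 injJ vd.
have [x xP] := trunc_counit_cout (erefl (idx n + 1)).
by exists (w ∘ x); rewrite -vP wP -!mcompA xP.
Qed.

Lemma theta_iso : is_iso theta.
Proof.
have zK := zaugY_kernel idxl (erefl (idx l + 1)).
apply: mono_epi_iso.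
- apply: (mono_injective_test eiB) => J u injJ.
  have [v vP] := injJ _ _ _ (u ∘ homology_proj FT l) (@cycles_in_mono _ FT l).
  have [w wP] := injJ _ _ _ v (@trunc_counit_mono l).
  exists (w ∘ zaugY (idx l)); apply: (@homology_proj_epi _ FT l).
  by rewrite -!mcompA thetaP mcompA wP vP.
- apply: (epi_injective_test eiB) => J u injJ uth.
  have [v vP] := injJ _ _ _ u (kernel_mono zK).
  have [|w wP] := trunc_counit_exact (v := v) (erefl (idx l + 1)) injJ.
    by rewrite -mcompA -thetaP mcompA vP mcompA uth mcomp0m.
  by rewrite -vP wP -mcompA zK.1 mcompm0.
Qed.

Lemma trunc_comparison :
  exists a : chain_map (pres epA coh_obj) trunc,
    trunc_aug ∘ a 0 = pres_aug epA coh_obj.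
Proof.
have [_ et ex0] := trunc_augP.
have [a aP] := pexact_comparison_exists (idm _) (presP epA _) et ex0 trunc_exact.
by exists a; rewrite aP mcomp1m.
Qed.

Lemma trunc_comparison_iso (a : chain_map (pres epA coh_obj) trunc) n :
  trunc_aug ∘ a 0 = pres_aug epA coh_obj ->
  is_iso (homology_map (map_chain_map (left_adjoint_additive adj) a) n).
Proof.
have [_ _ ex0] := trunc_augP => aP.
exact: (acyclic_comparison_iso eiB _ _ ex0 trunc_exact (presP epA _) aP
  trunc_acyclic).
Qed.

Lemma coh_obj_F_concentrated : F_concentrated epA adj l coh_obj.
Proof.
move=> [n|n] nl; last exact: zero_objP.
have [a aP] := trunc_comparison.
have [b bP] := trunc_comparison_iso n aP.
apply: (iso_is_zero (f := b)); last first.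
  by apply: trunc_homology_zero; apply/eqP => nl'; rewrite nl' in nl.
by exists (homology_map (map_chain_map (left_adjoint_additive adj) a) n); case: bP.
Qed.

End Object.

(** * Naturality in [Y] *)

Section Naturality.
Variables (Y Y' : B) (f : hom Y Y').

Let res_map : chain_map (injres Y') (injres Y) :=
  @pres_map (op_abelian_category B) (op_enough_projectives eiB) Y' Y f.

Let zf m : hom (zobj (injres Y) m) (zobj (injres Y') m) := zmap res_map m.

Lemma zaug_natural m : zaug (injaug Y') m ∘ f = zf m ∘ zaug (injaug Y) m.
Proof.
case: m => [[|n]|n]; rewrite ?mcompm0 ?mcomp0m //.
exact: esym (@pres_mapP (op_abelian_category B) (op_enough_projectives eiB)
  Y' Y f).
Qed.

Lemma trunc_map_ex n :
  exists x : hom (trunc_obj Y n) (trunc_obj Y' n),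
    trunc_in Y' n ∘ x = fmap G (zf (idx n)) ∘ trunc_in Y n.
Proof.
case: n => [|n]; last by eexists; exact: mcomp1m.
apply: ker_lift_ex; rewrite mcompA -fmapM zmap_zdiff // fmapM -mcompA.
by rewrite (@cocycles_inP Y l _ erefl).1 mcompm0.
Qed.

Let trunc_comp n := sval (cid (trunc_map_ex n)).

Let trunc_compP n :
  trunc_in Y' n ∘ trunc_comp n = fmap G (zf (idx n)) ∘ trunc_in Y n.
Proof. exact: svalP (cid (trunc_map_ex n)). Qed.

Definition trunc_map : chain_map (trunc Y) (trunc Y').
Proof.
exists trunc_comp => n; apply: trunc_in_mono.
rewrite mcompA trunc_in_diff -mcompA trunc_compP mcompA -fmapM.
rewrite zmap_zdiff ?fmapM; last exact: idxS.
by rewrite -mcompA -trunc_in_diff mcompA -trunc_compP -mcompA.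
Defined.

Let G_res_map : chain_map (Gcomplex Y') (Gcomplex Y) :=
  map_chain_map (F := op_functor G) (fun X Y f g => addG f g) res_map.

Definition coh_map : hom (coh_obj Y) (coh_obj Y') :=
  @of_op A (coh_obj Y) (coh_obj Y')
    (@homology_map (op_abelian_category A) (Gcomplex Y') (Gcomplex Y) G_res_map l).

Definition coh_quot_map : hom (coh_quot_obj Y) (coh_quot_obj Y') :=
  @of_op A (coh_quot_obj Y) (coh_quot_obj Y')
    (@cycles_map (op_abelian_category A) (Gcomplex Y') (Gcomplex Y) G_res_map l).

Lemma coh_map_in : coh_in Y' ∘ coh_map = coh_quot_map ∘ coh_in Y.
Proof.
exact: (@of_op_square A (coh_obj Y) (coh_obj Y') (coh_quot_obj Y)
  (coh_quot_obj Y') _ _ _ _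
  (@homology_mapP (op_abelian_category A) (Gcomplex Y') (Gcomplex Y) G_res_map l)).
Qed.

Lemma coh_quot_natural :
  coh_quot_map ∘ coh_quot Y = coh_quot Y' ∘ fmap G (zf l).
Proof.
exact: (@of_op_square A (G (zobj (injres Y) l)) (coh_quot_obj Y)
  (G (zobj (injres Y') l)) (coh_quot_obj Y') _ _ _ _
  (@cycles_mapP (op_abelian_category A) (Gcomplex Y') (Gcomplex Y) G_res_map l)).
Qed.

Lemma trunc_aug_natural :
  trunc_aug Y' ∘ trunc_map 0 = coh_map ∘ trunc_aug Y.
Proof.
have [tP' _ _] := trunc_augP Y'; have [tP _ _] := trunc_augP Y.
have tm : cocycles_in Y' l ∘ trunc_map 0 = fmap G (zf l) ∘ cocycles_in Y l.
  exact: trunc_compP 0%N.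
apply: coh_in_mono; rewrite !mcompA tP' coh_map_in -!mcompA tP tm !mcompA.
by rewrite coh_quot_natural.
Qed.

Lemma theta_natural :
  theta Y' ∘ homology_map (map_chain_map (left_adjoint_additive adj) trunc_map) l
  = f ∘ theta Y.
Proof.
apply: (@homology_proj_epi _ _ l).
have zK := zaugY_kernel Y' idxl (erefl (idx l + 1)).
apply: (kernel_mono zK).
rewrite -!(mcompA _ _ (homology_proj _ l)) homology_mapP.
rewrite (mcompA (theta Y')) mcompA thetaP -mcompA cycles_mapP.
rewrite (mcompA (zaug _ _)) zaug_natural -(mcompA (zf _)) thetaP !mcompA.
congr (_ ∘ _).
by rewrite /trunc_counit /= -mcompA -fmapM trunc_compP fmapM mcompA -counit_nat.
Qed.

End Naturality.

(** [eps] is the comparison [L_l F(H) -> H_l(F T)], for a chosen lift of the identity of [H],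
    followed by [theta]. *)
Lemma coh_counit_exists :
  (forall J : B, injective_obj J -> F_acyclic epA adj (G J)) ->
  (forall J : B, injective_obj J -> is_iso (counit adj J)) ->
  finite_homological_dimension epA adj ->
  exists eps : forall Y : B, G_concentrated eiB adj l Y ->
      hom (LF epA adj l (coh_obj Y)) Y,
    (forall Y (c : G_concentrated eiB adj l Y), is_iso (eps Y c)) /\
    forall Y Y' (c : G_concentrated eiB adj l Y)
      (c' : G_concentrated eiB adj l Y') (f : hom Y Y'),
      f ∘ eps Y c = eps Y' c' ∘ fmap (LF epA adj l) (coh_map f).
Proof.
move=> acGI isoc fd.
have cmp Y (c : G_concentrated eiB adj l Y) :
    {a : chain_map (pres epA (coh_obj Y)) (trunc Y) |
      trunc_aug Y ∘ a 0 = pres_aug epA (coh_obj Y)}.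
  exact/cid/trunc_comparison.
pose addF := left_adjoint_additive adj.
exists (fun Y c => theta Y ∘ homology_map (map_chain_map addF (sval (cmp Y c))) l).
split=> [Y c|Y Y' c c' f].
  apply: iso_comp; last exact: theta_iso.
  exact: trunc_comparison_iso (svalP (cmp Y c)).
case: (cmp Y c) (cmp Y' c') => [a aP] [a' aP'] /=.
rewrite mcompA -theta_natural -!mcompA -!homology_mapM; congr (_ ∘ _).
(* Both composites lift [coh_map f] from a projective resolution to the exact complex [trunc Y']. *)
apply: homology_map_homotopic.
have [_ _ ex0'] := trunc_augP Y'.
have [|s [s0 sS]] := pexact_comparison_homotopic
  (phi := comp_chain_map (trunc_map f) a)
  (psi := comp_chain_map a' (pres_map epA (coh_map f)))
  (presP epA (coh_obj Y)) ex0' (trunc_exact c').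
  by rewrite /= mcompA trunc_aug_natural -mcompA aP mcompA aP' pres_mapP.
exists (fun n => fmap F (s n)); split=> [|n] /=.
  by rewrite -!fmapM -addF -s0.
by rewrite -!fmapM -!addF -sS.
Qed.

End Core.

(** * Duality *)

(* The categories A and A' differ only in the proofs of their axioms. *)
Lemma left_derived_irrelevance
    (oA : Type) (hA : oA -> oA -> zmodType) (iA : forall X, hA X X)
    (cA : forall X Y Z, hA Y Z -> hA X Y -> hA X Z)
    (oB : Type) (hB : oB -> oB -> zmodType) (iB : forall X, hB X X)
    (cB : forall X Y Z, hB Y Z -> hB X Y -> hB X Z)
    a1 a2 a3 a4 a5 a1' a2' a3' a4' a5' b1 b2 b3 b4 b5 b1' b2' b3' b4' b5'
    (A := @Category oA hA iA cA a1 a2 a3 a4 a5)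
    (A' := @Category oA hA iA cA a1' a2' a3' a4' a5')
    (B := @Category oB hB iB cB b1 b2 b3 b4 b5)
    (B' := @Category oB hB iB cB b1' b2' b3' b4' b5')
    (abA : abelian A) (abA' : abelian A') (abB : abelian B) (abB' : abelian B')
    (Fo : oA -> oB) (Fm : forall X Y, hA X Y -> hB (Fo X) (Fo Y))
    F1 FM F1' FM'
    (F := @Functor A B Fo Fm F1 FM) (F' := @Functor A' B' Fo Fm F1' FM')
    (addF : additive_functor F) (addF' : additive_functor F')
    (epA : enough_projectives (AbelianCategory abA))
    (epA' : enough_projectives (AbelianCategory abA')) i
    (L := @left_derived (AbelianCategory abA) (AbelianCategory abB) epA F addF i)
    (L' := @left_derived (AbelianCategory abA') (AbelianCategory abB')
             epA' F' addF' i) :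
  @Functor (op_category A) (op_category B) (fobj L')
    (fun X Y f => @fmap _ _ L' Y X f) (fun X => fmap1 L' X)
    (fun X Y Z g f => @fmapM _ _ L' Z Y X f g) = op_functor L.
Proof.
have := Prop_irrelevance a1' a1; have := Prop_irrelevance a2' a2.
have := Prop_irrelevance a3' a3; have := Prop_irrelevance a4' a4.
have := Prop_irrelevance a5' a5; have := Prop_irrelevance b1' b1.
have := Prop_irrelevance b2' b2; have := Prop_irrelevance b3' b3.
have := Prop_irrelevance b4' b4; have := Prop_irrelevance b5' b5.
move=> *; subst.
have := Prop_irrelevance abA' abA; have := Prop_irrelevance abB' abB.
have := Prop_irrelevance F1' F1; have := Prop_irrelevance FM' FM.
move=> *; subst; rewrite {}/L' {}/L.
by rewrite (Prop_irrelevance addF' addF) (Prop_irrelevance epA' epA).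
Qed.

(** The double opposite has the same data but different proofs of the axioms; destructing the
    categories exposes the data, so that proof irrelevance applies. *)
Lemma op_op_left_derived (A B : abelian_category) (epA : enough_projectives A)
    (F : functor A B) (addF : additive_functor F)
    (eiA : enough_injectives (op_abelian_category A))
    (addF' : additive_functor (op_functor F)) (i : int) :
  @right_derived (op_abelian_category B) (op_abelian_category A) eiA
    (op_functor F) addF' i =
  op_functor (left_derived epA addF i).
Proof.
case: A epA F addF eiA addF' => -[oA hA iA cA a1 a2 a3 a4 a5] abA.
case: B  => -[oB hB iB cB b1 b2 b3 b4 b5] abB.
move=> epA [Fo Fm F1 FM] addF eiA addF'.
exact: left_derived_irrelevance.
Qed.

Definition concentrated (A B : category) (L : int -> functor A B) (l : int)
    (X : A) : Prop :=
  forall i : int, i <> l -> is_zero (L i X).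

(** Abstracted over families of functors, so that the dual half is obtained by rewriting with
    equalities of functors. *)
Definition half_equivalence (A B : category) (L : int -> functor A B)
    (R : int -> functor B A) (l : int) : Prop :=
  (forall Y, concentrated R l Y -> concentrated L l (R l Y)) /\
  exists eps : forall Y, concentrated R l Y -> hom (L l (R l Y)) Y,
    (forall Y (c : concentrated R l Y), is_iso (eps Y c)) /\
    forall Y Y' (c : concentrated R l Y) (c' : concentrated R l Y')
      (f : hom Y Y'),
      f ∘ eps Y c = eps Y' c' ∘ fmap (L l) (fmap (R l) f).

Section Halves.
Variables (A B : abelian_category).
Variables (epA : enough_projectives A) (eiB : enough_injectives B).
Variables (F : functor A B) (G : functor B A) (adj : adjunction F G).

Lemma LF_of_zero (X : A) i : is_zero X -> is_zero (LF epA adj i X).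
Proof.
move=> X0; case: i => [n|n]; last exact: zero_objP.
apply/(LF_zeroP epA eiB adj) => J _; case: n => [|n].
  have [_ eX exX _] := presP epA X => u ud.
  have [v <-] := epi_exact_factor eX exX ud.
  by exists 0; rewrite (X0.1 _ v) !mcomp0m.
apply: Ext_zero_projective => Y Z e f _.
by exists 0; rewrite mcompm0 (X0.1 _ f).
Qed.

Lemma half_tilting (l : int) :
  (forall J : B, injective_obj J -> F_acyclic epA adj (G J)) ->
  (forall J : B, injective_obj J -> is_iso (counit adj J)) ->
  finite_homological_dimension epA adj ->
  half_equivalence (LF epA adj) (RG eiB adj) l.
Proof.
move=> acGI isoc fd; case: l => l.
  split; first by move=> Y c; exact: (coh_obj_F_concentrated acGI isoc fd c).
  have [eps [isoeps nat_eps]] :=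
    @coh_counit_exists A B epA eiB F G adj l acGI isoc fd.
  exists eps; split; first exact: isoeps.
  move=> Y Y' c c' f; exact: (nat_eps Y Y' c c' f).
(* For negative [l] the functors [L_l F] and [R^l G] are zero and so are the concentrated objects;
   the zero map serves as [eps]. *)
have Y0 Y : concentrated (RG eiB adj) (Negz l) Y -> is_zero Y.
  move=> c; apply: (negative_concentrated_zero (b := Negz l) acGI isoc fd) => //.
  by move=> j lj; apply: c => jl; rewrite jl Order.POrderTheory.ltxx in lj.
split=> [Y c i _|].
  by apply: LF_of_zero; have [H1 H2] := zero_objP (op_abelian_category A).
exists (fun Y _ => 0); split=> [Y c|Y Y' c c' f]; last first.
  by rewrite mcompm0 mcomp0m.
apply: zero_iso; last exact: Y0.
exact: zero_objP.
Qed.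

End Halves.

Section Duality.
Variables (A B : abelian_category).
Variables (epA : enough_projectives A) (eiB : enough_injectives B).
Variables (F : functor A B) (G : functor B A) (adj : adjunction F G).

Let adj' := op_adjunction adj.
Let LF' := @LF (op_abelian_category B) (op_abelian_category A)
  (op_enough_projectives eiB) _ _ adj'.
Let RG' := @RG (op_abelian_category B) (op_abelian_category A) epA _ _ adj'.

Lemma LF_op i : LF' i = op_functor (RG eiB adj i).
Proof.
rewrite /LF' /LF /RG /right_derived.
rewrite (Prop_irrelevance
  (@left_adjoint_additive (op_abelian_category B) (op_abelian_category A) _ _ adj')
  (fun X Y f g => right_adjoint_additive adj f g)).
by case: (left_derived _ _ _).
Qed.

Lemma RG_op i : RG' i = op_functor (LF epA adj i).
Proof. exact: op_op_left_derived. Qed.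

Lemma half_tilting_op (l : int) :
  (forall P : A, projective_obj P -> G_acyclic eiB adj (F P)) ->
  (forall P : A, projective_obj P -> is_iso (unit adj P)) ->
  finite_cohomological_dimension eiB adj ->
  half_equivalence (fun i => op_functor (RG eiB adj i))
    (fun i => op_functor (LF epA adj i)) l.
Proof.
move=> acFP isou [d [d0 Rd]].
rewrite -(funext LF_op) -(funext RG_op).
apply: (@half_tilting (op_abelian_category B) (op_abelian_category A)
  (op_enough_projectives eiB) epA _ _ adj' l).
- move=> P projP i i0; rewrite -/LF' LF_op.
  by have [H1 H2] := acFP P projP i i0.
- by move=> P projP; have [u [u1 u2]] := isou P projP; exists u.
exists d; split=> [|Y]; first exact: d0.
change (is_zero (LF' d Y)); rewrite LF_op.
by have [H1 H2] := Rd Y.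
Qed.

End Duality.

(* The counit is corrected to eps o F(eta^-1) o eps^-1 in order to satisfy the
   triangle identities. *)
Lemma natural_isos_adjoint_equivalence (C D : category) (F : functor C D)
    (G : functor D C) (eta : forall X, hom X (G (F X)))
    (eps : forall Y, hom (F (G Y)) Y) :
  (forall X, is_iso (eta X)) -> (forall Y, is_iso (eps Y)) ->
  (forall X Y (f : hom X Y), eta Y ∘ f = fmap G (fmap F f) ∘ eta X) ->
  (forall X Y (f : hom X Y), f ∘ eps X = eps Y ∘ fmap F (fmap G f)) ->
  adjoint_equivalence F G.
Proof.
move=> isoeta isoeps eta_nat eps_nat.
pose eta' X := sval (cid (isoeta X)); pose eps' Y := sval (cid (isoeps Y)).
have [eta'K etaK] : (forall X, eta' X ∘ eta X = idm X) /\
    (forall X, eta X ∘ eta' X = idm _).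
  by split=> X; case: (svalP (cid (isoeta X))).
have [eps'K epsK] : (forall Y, eps' Y ∘ eps Y = idm _) /\
    (forall Y, eps Y ∘ eps' Y = idm Y).
  by split=> Y; case: (svalP (cid (isoeps Y))).
have eps'_nat X Y (f : hom X Y) : fmap F (fmap G f) ∘ eps' X = eps' Y ∘ f.
  apply: (iso_mono (isoeps Y)).
  by rewrite !mcompA epsK mcomp1m -eps_nat -mcompA epsK mcompm1.
have fmap_iso (C' D' : category) (K : functor C' D') X Y (f : hom X Y) :
    is_iso f -> is_iso (fmap K f).
  by move=> [g [gf fg]]; exists (fmap K g); rewrite -!fmapM gf fg !fmap1.
have etaGF X : eta (G (F X)) = fmap G (fmap F (eta X)).
  by apply: (iso_epi (isoeta X)); rewrite -eta_nat.
pose ct Y := eps Y ∘ fmap F (eta' (G Y)) ∘ eps' (F (G Y)).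
have iso_ct Y : is_iso (ct Y).
  apply: iso_comp; first by exists (eps (F (G Y))).
  apply: iso_comp => //; apply: fmap_iso.
  by exists (eta (G Y)).
have eta'_nat X Y (f : hom X Y) : f ∘ eta' X = eta' Y ∘ fmap G (fmap F f).
  apply: (iso_mono (isoeta Y)).
  by rewrite !mcompA etaK mcomp1m eta_nat -mcompA etaK mcompm1.
have ct_nat X Y (f : hom X Y) : f ∘ ct X = ct Y ∘ fmap F (fmap G f).
  rewrite /ct -!mcompA -eps'_nat !mcompA eps_nat; congr (_ ∘ _).
  by rewrite -!mcompA -!fmapM eta'_nat.
have tri1 X : ct (F X) ∘ fmap F (eta X) = idm (F X).
  rewrite /ct -!mcompA -eps'_nat -etaGF (mcompA (fmap F _)) -fmapM eta'K.
  by rewrite fmap1 mcomp1m epsK.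
(* By naturality and the first triangle identity this composite is idempotent; being invertible, it
   is the identity. *)
have tri2 Y : fmap G (ct Y) ∘ eta (G Y) = idm (G Y).
  set e := _ ∘ _; have isoe : is_iso e by apply: iso_comp => //; exact: fmap_iso.
  apply: (iso_mono isoe); rewrite mcompm1 {2}/e /e -!mcompA.
  rewrite (mcompA (eta (G Y))) eta_nat -!mcompA (mcompA (fmap G (ct Y))) -fmapM.
  rewrite -ct_nat fmapM etaGF -!mcompA (mcompA (fmap G (ct (F (G Y))))) -fmapM.
  by rewrite tri1 fmap1 mcomp1m.
by exists (Adjunction eta_nat ct_nat tri1 tri2).
Qed.

Theorem theorem3p14 (A B : abelian_category)
    (epA : enough_projectives A) (eiB : enough_injectives B)
    (F : functor A B) (G : functor B A) (adj : adjunction F G)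
    (tilt : tilting_adjunction epA eiB adj) (l : int) :
  exists (hL : forall X : A, F_concentrated epA adj l X ->
                 G_concentrated eiB adj l (LF epA adj l X))
         (hR : forall Y : B, G_concentrated eiB adj l Y ->
                 F_concentrated epA adj l (RG eiB adj l Y)),
    adjoint_equivalence
      (restrict_functor (F := LF epA adj l)
         (P := F_concentrated epA adj l) (Q := G_concentrated eiB adj l) hL)
      (restrict_functor (F := RG eiB adj l)
         (P := G_concentrated eiB adj l) (Q := F_concentrated epA adj l) hR).
Proof.
have [ta1 ta2 ta3 ta4] := tilt.
have [hR [eps [isoeps eps_nat]]] : half_equivalence (LF epA adj) (RG eiB adj) l.
  by apply: half_tilting => // J /ta3[].
(* A counit for the opposite adjunction is a map [X -> R^l G(L_l F(X))] in [A], hence the unit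
   sought. *)
have [hL' [eta [isoeta eta_nat]]] : half_equivalence
    (fun i => op_functor (RG eiB adj i)) (fun i => op_functor (LF epA adj i)) l.
  by apply: half_tilting_op => // P /ta1[].
have op_conc X : F_concentrated epA adj l X ->
    concentrated (fun i => op_functor (LF epA adj i)) l X.
  by move=> c i il; have [H1 H2] := c i il.
have hL X : F_concentrated epA adj l X -> G_concentrated eiB adj l (LF epA adj l X).
  by move=> c i il; have [H1 H2] := hL' X (op_conc X c) i il.
exists hL, hR.
set L := restrict_functor _; set R := restrict_functor _.
pose eta1 X : hom X (R (L X)) := eta (sval X) (op_conc _ (svalP X)).
pose eps1 Y : hom (L (R Y)) Y := eps (sval Y) (svalP Y).
apply: (natural_isos_adjoint_equivalence (eta := eta1) (eps := eps1)).
- by move=> X; have [u [u1 u2]] := isoeta (sval X) (op_conc _ (svalP X)); exists u.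
- by move=> Y; have [u [u1 u2]] := isoeps (sval Y) (svalP Y); exists u.
- by move=> X Y f; exact: (eta_nat (sval Y) (sval X) _ _ f).
by move=> X Y f; exact: (eps_nat (sval X) (sval Y) _ _ f).
Qed.
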